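(* Suppose $\mu_h>0$ and the regularizer is $M_h$-Lipschitz: $h^{\pi(\cdot\mid s)}(s)-h^{\pi'(\cdot\mid s)}(s)\le M_h\|\pi(\cdot\mid s)-\pi'(\cdot\mid s)\|$ for all $s,\pi,\pi'$. Run SPMD with $\eta_t=\frac{1}{\mu_h(t+1)}$, and let $\bar D_0>0$ satisfy $\max_{s,\pi}D^\pi_{\pi_0}(s)\le\bar D_0$. Let $k\ge1$. (i) If Assumption B holds, then for all $s\in\mathcal S$, $$\frac1k\sum_{t=0}^{k-1}\mathbb E[V^{\pi_t}(s)-V^{\pi^*}(s)]+\frac{\mu_h}{1-\gamma}\mathbb E_{q\sim\kappa^{\pi^*}_s}\mathbb E[D^{\pi^*}_{\pi_k}(q)]\le\frac{\mu_h\bar D_0+\mu_h^{-1}(\bar Q^2+M_h^2)\log(2k)+2\varsigma k}{(1-\gamma)k}.$$ (ii) If Assumption B holds and $\varsigma\le\sigma/k$, then for any $\delta\in(0,1]$, $$\Pr\Big\{\exists s:\ \frac1k\sum_{t=0}^{k-1}[V^{\pi_t}(s)-V^{\pi^*}(s)]+\frac{\mu_h}{1-\gamma}\mathbb E_{q\sim\kappa^{\pi^*}_s}[D^{\pi^*}_{\pi_k}(q)]>\frac{\mu_h\bar D_0+[25\mu_h^{-1}(\bar Q^2+M_h^2)+2\sigma\sqrt{3C(k)}](\log(4k|\mathcal S|/\delta))^{3/2}}{(1-\gamma)k}\Big\}\le(k+1)\delta,$$ where $C(k):=\frac{6\bar D_0}{1-\gamma}+\frac{75(\bar Q^2+M_h^2)(\log(4k|\mathcal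 S|/\delta))^{3/2}}{(1-\gamma)\mu_h^2}+\frac{108\sigma^2(\log(4k|\mathcal S|/\delta))^3}{(1-\gamma)^2\mu_h^2}$.
   Context: MDP: finite $\mathcal S$, $\mathcal A$, transition probabilities $\mathcal P(s'\mid s,a)$, cost $c$, discount $\gamma\in[0,1)$; policies assign $\pi(\cdot\mid s)\in\Delta_{|\mathcal A|}$. $\|\cdot\|$ is a norm on $\mathbb R^{|\mathcal A|}$ with $\max_{p\in\Delta_{|\mathcal A|}}\|p\|\le1$ and dual norm $\|\cdot\|_*$; for $F:\mathcal S\times\mathcal A\to\mathbb R$, $\|F\|_*:=\max_s\|F(s,\cdot)\|_*$. $\omega$ is a differentiable distance-generating function on $\Delta_{|\mathcal A|}$, 1-strongly convex w.r.t. $\|\cdot\|$; $D^{\pi'}_\pi(s):=\omega(\pi'(\cdot\mid s))-\omega(\pi(\cdot\mid s))-\langle\nabla\omega(\pi(\cdot\mid s)),\pi'(\cdot\mid s)-\pi(\cdot\mid s)\rangle$. For each $s$, $p\mapsto h^p(s)$ is closed convex with $h^{p}(s)-h^{p'}(s)-\langle (h')^{p'}(s,\cdot),p-p'\rangle\ge\mu_h[\omega(p)-\omega(p')-\langle\nabla\omega(p'),p-p'\rangle]$. $V^\pi(s)=\mathbb E[\sum_{t\ge0}\gamma^t(c(s_t,a_t)+h^{\pi(\cdot\mid s_t)}(s_t))\mid s_0=s,\ a_t\sim\pi(\cdot\mid s_t),\ s_{t+1}\sim\mathcal P(\cdot\mid s_t,a_t)]$, $Q^\pi(s,a)$ the same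 with $a_0=a$; $\pi^*$ is an optimal policy; $\kappa^\pi_s(q):=(1-\gamma)\sum_{t\ge0}\gamma^t\Pr^\pi\{s_t=q\mid s_0=s\}$. SPMD: a random vector $\xi_t$ produces an estimate $\tilde Q^{\pi_t}$ of $Q^{\pi_t}$ and $\pi_{t+1}(\cdot\mid s)=\operatorname{argmin}_{p\in\Delta_{|\mathcal A|}}\{\eta_t[\langle\tilde Q^{\pi_t}(s,\cdot),p\rangle+h^p(s)]+\omega(p)-\omega(\pi_t(\cdot\mid s))-\langle\nabla\omega(\pi_t(\cdot\mid s)),p-\pi_t(\cdot\mid s)\rangle\}$; $\pi_t$ is determined by $\xi_{[t-1]}$. Assumption B: there are $\varsigma,\sigma,\bar Q\ge0$ with $\|\mathbb E_{\xi_t\mid\xi_{[t-1]}}[\tilde Q^{\pi_t}]-Q^{\pi_t}\|_*\le\varsigma$, $\mathbb E_{\xi_t\mid\xi_{[t-1]}}\exp\{\|\tilde Q^{\pi_t}-Q^{\pi_t}\|_*^2/\sigma^2\}\le2$, $\mathbb E_{\xi_t\mid\xi_{[t-1]}}\exp\{\|\tilde Q^{\pi_t}\|_*^2/\bar Q^2\}\le2$ for all $t$. *)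

(* Defs.v *)
From HB Require Import structures.
From mathcomp Require Import all_boot all_order all_algebra.
From mathcomp Require Import all_classical all_reals all_analysis.
Set Implicit Arguments. Unset Strict Implicit. Unset Printing Implicit Defensive.
Import Order.TTheory GRing.Theory Num.Theory.
Import numFieldNormedType.Exports.
Local Open Scope classical_set_scope.
Local Open Scope ring_scope.

Section MDP.
Variables (R : realType) (S A : finType).

Definition dotA (y x : A -> R) : R := \sum_(a : A) y a * x a.

Definition in_simplex (p : A -> R) : Prop :=
  (forall a, 0 <= p a) /\ \sum_(a : A) p a = 1.

Definition is_policy (pi : S -> A -> R) : Prop := forall s, in_simplex (pi s).

Definition is_norm (nrm : (A -> R) -> R) : Prop :=
  [/\ (forall x, 0 <= nrm x),
      (forall x, nrm x = 0 -> forall a, x a = 0),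
      (forall r x, nrm (fun a => r * x a) = `|r| * nrm x) &
      (forall x y, nrm (fun a => x a + y a) <= nrm x + nrm y)].

Definition dual_norm (nrm : (A -> R) -> R) (y : A -> R) : R :=
  sup [set dotA y x | x in [set x | nrm x <= 1]].

Definition dual_normF (nrm : (A -> R) -> R) (F : S -> A -> R) : R :=
  \big[Num.max/0]_(s : S) dual_norm nrm (F s).

Definition breg (w : (A -> R) -> R) (gw : (A -> R) -> A -> R)
  (p' p : A -> R) : R :=
  w p' - w p - dotA (gw p) (fun a => p' a - p a).

Definition grad_on_simplex (w : (A -> R) -> R) (gw : (A -> R) -> A -> R) :=
  forall p q, in_simplex p -> in_simplex q ->
    (fun t : R => (w (fun a => p a + t * (q a - p a)) - w p) / t)
      @ 0^'+ --> dotA (gw p) (fun a => q a - p a).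

Definition strongly_convex1 (nrm : (A -> R) -> R) (w : (A -> R) -> R) :=
  forall p q (l : R), in_simplex p -> in_simplex q -> 0 <= l <= 1 ->
    w (fun a => l * p a + (1 - l) * q a) <=
    l * w p + (1 - l) * w q
      - l * (1 - l) / 2 * (nrm (fun a => p a - q a)) ^+ 2.

Definition convex_on_simplex (f : (A -> R) -> R) :=
  forall p q (l : R), in_simplex p -> in_simplex q -> 0 <= l <= 1 ->
    f (fun a => l * p a + (1 - l) * q a) <= l * f p + (1 - l) * f q.

Variables (P : S -> A -> S -> R) (c : S -> A -> R) (gamma : R)
          (h : S -> (A -> R) -> R).

Definition Ppi (pi : S -> A -> R) (s q : S) : R :=
  \sum_(a : A) pi s a * P s a q.

(* stepd pi t s q = Pr^pi { s_t = q | s_0 = s } *)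
Fixpoint stepd (pi : S -> A -> R) (t : nat) (s q : S) : R :=
  match t with
  | 0 => (s == q)%:R
  | t'.+1 => \sum_(q' : S) stepd pi t' s q' * Ppi pi q' q
  end.

Definition cpi (pi : S -> A -> R) (q : S) : R :=
  \sum_(a : A) pi q a * c q a + h q (pi q).

(* V^pi(s) = sum_t gamma^t E[c(s_t,a_t) + h^{pi(s_t)}(s_t) | s_0 = s] *)
Definition Vf (pi : S -> A -> R) (s : S) : R :=
  limn (series (fun t => gamma ^+ t * \sum_(q : S) stepd pi t s q * cpi pi q)).

(* Q^pi(s,a): same with a_0 = a (so s_1 ~ P(.|s,a), then follow pi) *)
Definition Qf (pi : S -> A -> R) (s : S) (a : A) : R :=
  c s a + h s (pi s) +
  limn (series (fun t => gamma ^+ t.+1 *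
     \sum_(q' : S) P s a q' * \sum_(q : S) stepd pi t q' q * cpi pi q)).

Definition kappa (pi : S -> A -> R) (s q : S) : R :=
  (1 - gamma) * limn (series (fun t => gamma ^+ t * stepd pi t s q)).

Definition is_optimal (pistar : S -> A -> R) : Prop :=
  is_policy pistar /\
  forall pi, is_policy pi -> forall s, Vf pistar s <= Vf pi s.

End MDP.

Section Prob.
Local Open Scope ereal_scope.
Variables (R : realType) (d : measure_display) (Omega : measurableType d)
          (Pr : probability Omega R).

Definition G_measurable (G : set (set Omega)) (X : Omega -> R) : Prop :=
  forall B : set R, measurable B -> G (X @^-1` B).

Definition is_cond_exp (G : set (set Omega)) (X Y : Omega -> R) : Prop :=
  [/\ Pr.-integrable setT (EFin \o X),
      G_measurable G Y,
      Pr.-integrable setT (EFin \o Y) &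
      forall B, G B ->
        \int[Pr]_(w in B) (X w)%:E = \int[Pr]_(w in B) (Y w)%:E].

Definition gen_sigma (d' : measure_display) (Xi : measurableType d')
  (xi : nat -> Omega -> Xi) (t : nat) : set (set Omega) :=
  <<s \bigcup_(i in `I_t) preimage_set_system setT (xi i) measurable >>.

End Prob.

(* Main.v *)
(** Strong convexity of the regularizer makes one step of mirror descent contract: with
    [eta_t = 1 / (mu (t + 1))], the three-point inequality, averaged over the occupation measure
    [kappa] of the optimal policy and combined with the performance difference identity, gives on
    every sample path
      [(1 - gamma) (V_t - Vstar) + mu (t + 2) d_(t+1)
         <= mu (t + 1) d_t + (|Q~_t|^2 + M^2) / (mu (t + 2)) + zeta_t],
    where [d_t = E_kappa D(pistar, pi_t)] and [zeta_t = E_kappa <Q~_t - Q_t, pistar - pi_t>]. It telescopes.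
    For (i), [E zeta_t <= 2 varsigma], [E |Q~_t|^2 <= Qbar^2] and [sum 1 / (t + 2) <= ln (k + 1)].
    For (ii), [|zeta_t| <= |Q~_t - Q_t| sqrt (2 d_t)] has conditionally light tails of scale
    [sigma sqrt (2 d_t)]. Truncating [zeta_t] to the event [d_t <= K / (t + 1)], with [K = C(k) / 2],
    makes its variance proxy summable to [O (sigma^2 K ln k)], so that a Chernoff bound, with the union
    over states and horizons absorbed into one exponential moment, controls the truncated sums. On
    the resulting event, induction on [t] in the recursion shows that the truncation is never active. *)
Require Import Defs.
From HB Require Import structures.
From mathcomp Require Import all_boot all_order all_algebra.
From mathcomp Require Import all_classical all_reals all_analysis.
From mathcomp Require Import measurable_realfun ring lra.
Import Order.TTheory GRing.Theory Num.Theory.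
Import numFieldNormedType.Exports.
Set Implicit Arguments. Unset Strict Implicit. Unset Printing Implicit Defensive.
Local Open Scope classical_set_scope.
Local Open Scope ring_scope.

(** * Exponentials, logarithms and harmonic sums *)

(** The obstacle in (ii) is circular: the tail of [zeta_t] scales with [sqrt d_t], while [d_t] is
    what the bound has to control. With [m ^+ 2 = C / 2], the multiplier [lam = 1 / (2 sigma m)] is
    the one for which, on the truncation event, [2 (lam zeta_t)^2] is at most [1 / (t + 1)] times
    the exponent of Assumption B. Apart from the bias, step [t] then costs a factor
    [2 ^ (1 / (t + 1))], and the total cost is harmonic. The resulting bound on [mu (t + 1) d_t]
    contains a term linear in [m] and has to stay below [mu m^2]; [C] is large enough to solve this
    quadratic inequality. Conditional expectations are known only through integrals over sets of the
    past. Exponentials are therefore bounded pointwise by a conditionally centred term plus an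
    affine function of a variable of conditional mean at most 2, which replaces a conditional Jensen
    inequality. Measurability of [om], [h] and [gom] along the iterates is derived from convexity:
    suprema of affine functions, and limits of difference quotients. *)

Section Elementary.
Context {R : realType}.
Implicit Types x y p : R.

(** For centred [x] the linear term integrates to zero, so only the exponential of a square remains,
    which Assumption B controls. The factor 2 lets [1 + y <= exp y] suffice: for [x < 1/2] it gives
    [exp x <= 1 / (1 - x)], and [(1 - x) (1 + x + 2 x^2) = 1 + x^2 (1 - 2 x)]. *)
Lemma expR_le_addr_expR_sqr x : expR x <= x + expR (2 * x ^+ 2).
Proof.
have [x_ge|x_lt] := leP (2^-1) x.
  have : expR x <= expR (2 * x ^+ 2) by rewrite ler_expR; nra.
  by lra.
have h1 : expR x <= (1 - x)^-1.
  rewrite -[leLHS]invrK -expRN lef_pV2 ?posrE ?expR_gt0 //; last by lra.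
  exact: expR_ge1Dx.
have h2 : (1 - x)^-1 <= 1 + x + 2 * x ^+ 2.
  by rewrite -[leLHS]mul1r ler_pdivrMr; [nra|lra].
by have := expR_ge1Dx (2 * x ^+ 2); lra.
Qed.

(** Weighted AM-GM applied to [2 ^ p * (exp y / 2) ^ p]. The bound is affine in [exp y], so it
    passes through a conditional expectation by linearity, and at [exp y = 2] it equals [2 ^ p]. *)
Lemma expRM_le_interp p y : 0 <= p <= 1 ->
  expR (p * y) <= expR (p * ln 2) * (1 - p + p / 2 * expR y).
Proof.
move=> /andP[p0 p1]; set u := y - ln 2.
have -> : p * y = p * ln 2 + p * u by rewrite /u; ring.
rewrite expRD ler_pM2l ?expR_gt0 //.
have -> : p / 2 * expR y = p * expR u.
  by rewrite /u expRD expRN lnK ?posrE //; ring.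
have e0 : expR (p * u) * (1 - p * u) <= 1.
  rewrite -ler_pdivlMl ?expR_gt0 // mulr1 -expRN.
  by have := expR_ge1Dx (- (p * u)); lra.
have e1 : expR (p * u) * (1 + (u - p * u)) <= expR u.
  have -> : expR u = expR (p * u) * expR (u - p * u) by rewrite -expRD; congr expR; ring.
  by rewrite ler_pM2l ?expR_gt0 // expR_ge1Dx.
by nra.
Qed.

Lemma expRM_interp2 p : expR (p * ln 2) * (1 - p + p / 2 * 2) = expR (p * ln 2) :> R.
Proof. by field. Qed.

(** Precise enough for [2 + 71/50 + 2 * (18/25) <= 2 * (61/25)], the numerical inequality behind
    [good_event_bound]. It follows from [(1 + x / 16) ^ 16 <= exp x] by repeated squaring. *)
Lemma ln2_le : ln 2 <= 18 / 25 :> R.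
Proof.
rewrite -ler_expR lnK ?posrE //.
have -> : 18 / 25 = 16%:R * (9 / 200) :> R by field.
rewrite expRM_natl; apply: (@le_trans _ _ ((1 + 9 / 200) ^+ 16)).
  have sqr_le (b b' c : R) n : b <= c ^+ n -> 0 <= b -> b' <= b ^+ 2 -> b' <= c ^+ (n * 2).
    by move=> bc b0 /le_trans; apply; rewrite exprM lerXn2r ?nnegrE // (le_trans b0 bc).
  have h2 : 1092 / 1000 <= (1 + 9 / 200) ^+ 2 :> R by lra.
  have h4 : 119 / 100 <= (1 + 9 / 200) ^+ 4 :> R.
    by apply: (sqr_le _ _ _ 2%N h2); lra.
  have h8 : 1416 / 1000 <= (1 + 9 / 200) ^+ 8 :> R.
    by apply: (sqr_le _ _ _ 4%N h4); lra.
  by apply: (sqr_le _ _ _ 8%N h8); lra.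
by rewrite lerXn2r ?nnegrE ?expR_ge0 ?expR_ge1Dx//; lra.
Qed.

(** The 4 inside the logarithm of (ii) pays for the 1 in [1 + ln k]. *)
Lemma ln4_ge1 : 1 <= ln 4 :> R.
Proof.
rewrite -ler_expR lnK ?posrE //.
have h : expR (1 / 2) <= 2 :> R.
  rewrite -lef_pV2 ?posrE ?expR_gt0 // -expRN.
  by have := expR_ge1Dx (- (1 / 2) : R); lra.
have -> : (1 : R) = 1 / 2 + 1 / 2 by field.
by rewrite expRD; have := expR_gt0 (1 / 2 : R); nra.
Qed.

Lemma sum_invS2_le_ln k : \sum_(t < k) (t.+2%:R)^-1 <= ln (k.+1%:R) :> R.
Proof.
elim: k => [|k IH]; first by rewrite big_ord0 ln1.
rewrite big_ord_recr /=.
have k1 : (0 : R) < k.+1%:R by [].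
have k2 : (0 : R) < k.+2%:R by [].
have -> : ln (k.+2%:R) = ln k.+1%:R - ln (k.+1%:R / k.+2%:R) :> R.
  by rewrite ln_div ?posrE //; ring.
have e : k.+1%:R / k.+2%:R = 1 + - (k.+2%:R)^-1 :> R.
  by rewrite -[in LHS](@addrK R 1 k.+1%:R) -natr1; field; rewrite -natrD pnatr_eq0.
have : ln (k.+1%:R / k.+2%:R : R) <= - (k.+2%:R)^-1.
  by rewrite e; apply: le_ln1Dx; rewrite ltrN2 invf_lt1 // ltr1n.
by move=> H; apply: lerD IH _; rewrite lerNr.
Qed.

Lemma sum_invS_le_ln k : (0 < k)%N -> \sum_(t < k) (t.+1%:R)^-1 <= 1 + ln k%:R :> R.
Proof.
case: k => // k _; rewrite big_ord_recl /= invr1 lerD2l.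
exact: sum_invS2_le_ln.
Qed.

End Elementary.

(** * The mirror descent step *)

Section Dot.
Context {R : realType} {A : finType}.
Implicit Types x y p q : A -> R.

Lemma dotAB y p q : dotA y (fun a => p a - q a) = dotA y p - dotA y q.
Proof. by rewrite /dotA -sumrB; apply: eq_bigr => a _; ring. Qed.

Lemma dotBA y z x : dotA (fun a => y a - z a) x = dotA y x - dotA z x.
Proof. by rewrite /dotA -sumrB; apply: eq_bigr => a _; ring. Qed.

Lemma dotAZ y p (r : R) : dotA y (fun a => r * p a) = r * dotA y p.
Proof. by rewrite /dotA big_distrr; apply: eq_bigr => a _; rewrite mulrCA. Qed.

Lemma dotA_segment y p q (t : R) :
  dotA y (fun a => p a + t * (q a - p a)) = (1 - t) * dotA y p + t * dotA y q.
Proof.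
by rewrite /dotA !big_distrr -big_split /=; apply: eq_bigr => a _; ring.
Qed.

Lemma in_simplex_segment p q (t : R) : in_simplex p -> in_simplex q ->
  0 <= t <= 1 -> in_simplex (fun a => p a + t * (q a - p a)).
Proof.
move=> [p0 p1] [q0 q1] /andP[t0 t1]; split.
  by move=> a; have := p0 a; have := q0 a; nra.
by rewrite big_split /= -big_distrr /= sumrB p1 q1; ring.
Qed.

End Dot.

(** * Bounds on one-sided limits of difference quotients at 0 *)

Section RightLimit.
Context {R : realType}.
Implicit Types (f : R -> R) (a b l : R).

Lemma cvg_at_right0_le f l a b : f t @[t --> 0^'+] --> l ->
  (forall t, 0 < t < 1 -> f t <= a + t * b) -> l <= a.
Proof.
move=> fl fab.
have gl : (fun t : R => a + t * b) t @[t --> 0^'+] --> a.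
  rewrite -[X in _ --> X]addr0 -[X in _ --> _ + X](mul0r b).
  apply: cvgD; first exact: cvg_cst.
  by apply: cvgMl; apply: cvg_at_right_filter; exact: cvg_id.
apply: ler_cvg_to fl gl _; near=> t; apply: fab; apply/andP; split.
  by near: t; exact: nbhs_right_gt.
by near: t; exact: nbhs_right_lt.
Unshelve. all: by end_near.
Qed.

Lemma cvg_at_right0_ge f l a : f t @[t --> 0^'+] --> l ->
  (forall t, 0 < t < 1 -> a <= f t) -> a <= l.
Proof.
move=> fl fab; rewrite -lerN2.
apply: (@cvg_at_right0_le (fun t => - f t) _ _ 0); first exact: cvgN.
by move=> t t01; rewrite mulr0 addr0 lerN2; exact: fab.
Qed.

End RightLimit.

Section MirrorStep.
Context {R : realType} {A : finType}.
Variables (nrm : (A -> R) -> R) (om : (A -> R) -> R) (gom : (A -> R) -> A -> R).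
Hypothesis Hnrm : is_norm nrm.
Hypothesis Hgom : grad_on_simplex om gom.
Hypothesis Hom : strongly_convex1 nrm om.
Implicit Types (p q y : A -> R).

(** On the segment from [q] to [p], strong convexity bounds the difference quotient of [om] by
    [om p - om q - (1 - t) * n ^+ 2 / 2]; the limit [t -> 0+] turns the quotient into the gradient
    term. *)
Lemma breg_ge p q : in_simplex p -> in_simplex q ->
  (nrm (fun a => p a - q a)) ^+ 2 / 2 <= breg om gom p q.
Proof.
move=> sp sq; set n := nrm _.
suff : dotA (gom q) (fun a => p a - q a) <= om p - om q - n ^+ 2 / 2.
  by rewrite /breg; lra.
apply: (cvg_at_right0_le (b := n ^+ 2 / 2)) (Hgom sq sp) _ => t /andP[t0 t1].
have h : 0 <= t <= 1 by rewrite !ltW.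
have := Hom sp sq h; rewrite -/n.
have -> : (fun a => t * p a + (1 - t) * q a) = (fun a => q a + t * (p a - q a)).
  by apply: funext => a; ring.
by rewrite ler_pdivrMr //; nra.
Qed.

Lemma breg_ge0 p q : in_simplex p -> in_simplex q -> 0 <= breg om gom p q.
Proof.
move=> sp sq; apply: le_trans (breg_ge sp sq).
by rewrite divr_ge0 // sqr_ge0.
Qed.

Variables (h : (A -> R) -> R) (h' : (A -> R) -> A -> R) (mu : R).
Hypothesis mu0 : 0 < mu.
Hypothesis Hh' : forall p p', in_simplex p -> in_simplex p' ->
  h p - h p' - dotA (h' p') (fun a => p a - p' a) >= mu * breg om gom p p'.

(** The function [h - mu * om] is convex along segments: in the average of the strong convexity
    inequalities from the intermediate point [m] to both ends, the linear terms in [h' m] and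
    [gom m] cancel. This eliminates [h'], whose value at a minimizer has no known relation to
    optimality. *)
Lemma rel_convex_segment p q t : in_simplex p -> in_simplex q -> 0 <= t <= 1 ->
  h (fun a => p a + t * (q a - p a)) <= (1 - t) * h p + t * h q +
   mu * (om (fun a => p a + t * (q a - p a)) - (1 - t) * om p - t * om q).
Proof.
move=> sp sq t01; set m := fun a => _; have sm := in_simplex_segment sp sq t01.
have := Hh' sp sm; have := Hh' sq sm; rewrite /breg !dotAB -/m.
have E v : dotA v m = (1 - t) * dotA v p + t * dotA v q by exact: dotA_segment.
rewrite !E.
move: (dotA _ _) (dotA _ _) (dotA _ _) (dotA _ _) => x1 x2 x3 x4.
move: (h m) (om m) (h p) (h q) (om p) (om q) => hm omm hp hq omp omq.
case/andP: t01 => t0 t1 hq' hp'.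
have t1' : 0 <= 1 - t by lra.
have := ler_wpM2l t0 hq'; have := ler_wpM2l t1' hp'.
by lra.
Qed.

(** Minimality is tested at [p1 + t (p - p1)]. There [h] is bounded by its convexity relative to
    [om], so only [om] is differentiated at [t = 0+]; the coefficient [1 + eta * mu] adds its own
    occurrence to the one coming from [h]. *)
Lemma three_point (eta : R) y p0 p1 : 0 <= eta ->
  in_simplex p0 -> in_simplex p1 ->
  (forall p, in_simplex p ->
    eta * (dotA y p1 + h p1) + breg om gom p1 p0 <=
    eta * (dotA y p + h p) + breg om gom p p0) ->
  forall p, in_simplex p ->
    eta * (dotA y p1 + h p1) + breg om gom p1 p0 + (1 + eta * mu) * breg om gom p p1
    <= eta * (dotA y p + h p) + breg om gom p p0.
Proof.
move=> eta0 s0 s1 min p sp.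
have e0 : 0 < 1 + eta * mu by rewrite ltr_pwDl // mulr_ge0 // ltW.
set D := dotA (gom p1) (fun a => p a - p1 a).
(* The claim, solved for the derivative [D], reads [a / (1 + eta * mu) <= D]; the difference
   quotients satisfy the same bound at every [t]. *)
pose a := - (eta * (dotA y p - dotA y p1 + h p - h p1 - mu * (om p - om p1))
             - (dotA (gom p0) p - dotA (gom p0) p1)).
suff : a / (1 + eta * mu) <= D.
  rewrite ler_pdivrMr //; have -> : breg om gom p p1 = om p - om p1 - D by [].
  by rewrite /a /breg !dotAB; lra.
apply: cvg_at_right0_ge (Hgom s1 sp) _ => t /andP[t0 t1].
have t01 : 0 <= t <= 1 by rewrite !ltW.
have := rel_convex_segment s1 sp t01.
have := min _ (in_simplex_segment s1 sp t01).
rewrite /breg !dotAB !dotA_segment.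
set m := fun a => _; move: (om m) (h m) => omm hm hmin hconv.
rewrite ler_pdivrMr // mulrAC ler_pdivlMr //.
have := ler_wpM2l eta0 hconv.
by rewrite /a; lra.
Qed.

Variable M : R.
Hypothesis Hlip : forall p p', in_simplex p -> in_simplex p' ->
  h p - h p' <= M * nrm (fun a => p a - p' a).

(* Strong convexity improves the Lipschitz bound by a Bregman term; this is what turns 1/(t+1) into 1/(t+2), hence the harmonic sum into a bare logarithm. *)
Lemma lip_sub_breg p0 p1 : in_simplex p0 -> in_simplex p1 ->
  h p0 - h p1 <= M * nrm (fun a => p0 a - p1 a) - mu * breg om gom p1 p0.
Proof.
move=> s0 s1; set r := nrm _.
set D := dotA (gom p0) (fun a => p1 a - p0 a).
suff : (- (M * r) - (h p1 - h p0)) / mu + (om p1 - om p0) <= D.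
  rewrite -lerBrDr ler_pdivrMr //.
  have -> : breg om gom p1 p0 = om p1 - om p0 - D by [].
  by lra.
apply: cvg_at_right0_ge (Hgom s0 s1) _ => t /andP[t0 t1].
have t01 : 0 <= t <= 1 by rewrite !ltW.
have := rel_convex_segment s0 s1 t01.
have := Hlip s0 (in_simplex_segment s0 s1 t01).
have -> : (fun a => p0 a - (p0 a + t * (p1 a - p0 a))) = (fun a => t * (p0 a - p1 a)).
  by apply: funext => a; ring.
case: Hnrm => _ _ -> _; rewrite -/r gtr0_norm //.
set m := fun a => _; move: (om m) (h m) => omm hm hl hc.
rewrite ler_pdivlMr //.
rewrite -(ler_pM2l mu0) mulrA.
have -> : mu * ((- (M * r) - (h p1 - h p0)) / mu + (om p1 - om p0)) =
  - (M * r) - (h p1 - h p0) + mu * (om p1 - om p0) by field; rewrite gt_eqF.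
by nra.
Qed.

(** Multiplied by [mu (t + 1)], the three-point inequality carries the new divergence with
    coefficient [mu (t + 2)]. The displacement from [p0] to [p1] is penalized by [mu (t + 1)] from
    the step and by [mu] from [lip_sub_breg], so the linear terms are absorbed at weight
    [mu (t + 2)] too. *)
Lemma mirror_step (X : R) (t : nat) y p0 p1 : in_simplex p0 -> in_simplex p1 ->
  (forall x, dotA y x <= X * nrm x) ->
  (forall p, in_simplex p ->
    (mu * t.+1%:R)^-1 * (dotA y p1 + h p1) + breg om gom p1 p0 <=
    (mu * t.+1%:R)^-1 * (dotA y p + h p) + breg om gom p p0) ->
  forall p, in_simplex p ->
  dotA y p0 - dotA y p + h p0 - h p + mu * t.+2%:R * breg om gom p p1
   <= mu * t.+1%:R * breg om gom p p0 + (X ^+ 2 + M ^+ 2) / (mu * t.+2%:R).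
Proof.
move=> s0 s1 yX min p sp.
have E : 0 < mu * t.+1%:R by rewrite mulr_gt0.
have N0 : 0 < mu * t.+2%:R by rewrite mulr_gt0.
have tE : t.+2%:R = t.+1%:R + 1 :> R by rewrite -natr1.
have ei : 0 <= (mu * t.+1%:R)^-1 by rewrite invr_ge0 ltW.
have := three_point ei s0 s1 min sp; have := lip_sub_breg s0 s1; have := breg_ge s1 s0.
have -> : nrm (fun a => p1 a - p0 a) = nrm (fun a => p0 a - p1 a).
  have -> : (fun a => p1 a - p0 a) = (fun a => -1 * (p0 a - p1 a)).
    by apply: funext => a; ring.
  by case: Hnrm => _ _ -> _; rewrite normrN1 mul1r.
have := yX (fun a => p0 a - p1 a); rewrite dotAB.
move: (breg _ _ p1 p0) (breg _ _ p p0) (breg _ _ p p1) (nrm _) => b10 b0 b1 r hX hD hl.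
have N_E : mu * t.+2%:R = mu * t.+1%:R + mu by rewrite tE; ring.
(* Young's inequality, then [(X + M)^2 <= 2 (X^2 + M^2)]; the two squares supplied below are the
   deficits of these two estimates. *)
have key : (X + M) * r - mu * t.+2%:R * (r ^+ 2 / 2) <=
    (X ^+ 2 + M ^+ 2) / (mu * t.+2%:R).
  rewrite ler_pdivlMr //; move: (mu * t.+2%:R) => N.
  by have := sqr_ge0 (N * r - X - M); have := sqr_ge0 (X - M); nra.
have := ler_wpM2l (ltW N0) hD; move: key hl.
set F := _ / (mu * t.+2%:R); clearbody F.
rewrite N_E; move: (mu * t.+1%:R) E => e e0 k1 k2 k3.
rewrite -(ler_pM2l e0).
have -> : e * (e^-1 * (dotA y p1 + h p1) + b10 + (1 + e^-1 * mu) * b1) =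
   dotA y p1 + h p1 + e * b10 + (e + mu) * b1 by field; rewrite gt_eqF.
have -> : e * (e^-1 * (dotA y p + h p) + b0) = dotA y p + h p + e * b0.
  by field; rewrite gt_eqF.
by lra.
Qed.

End MirrorStep.

(** * Norms on [A -> R] and their duals *)

Section DualNorm.
Context {R : realType} {A : finType}.
Variable (nrm : (A -> R) -> R).
Hypothesis Hnrm : is_norm nrm.
Implicit Types (x y : A -> R).

Let nrmZ r x : nrm (fun a => r * x a) = `|r| * nrm x.
Proof. by case: Hnrm. Qed.

Let nrm_ge0 x : 0 <= nrm x.
Proof. by case: Hnrm. Qed.

Let nrmD x y : nrm (fun a => x a + y a) <= nrm x + nrm y.
Proof. by case: Hnrm. Qed.

Lemma nrm0 : nrm (fun=> 0) = 0.
Proof.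
have -> : (fun=> 0) = (fun a : A => 0 * (fun=> 0) a) :> (A -> R).
  by apply: funext => a; rewrite mul0r.
by rewrite nrmZ normr0 mul0r.
Qed.

Lemma nrm_le_coord : exists2 B, 0 <= B &
  forall (e : R) x, (forall a, `|x a| <= e) -> nrm x <= B * e.
Proof.
pose u b : A -> R := fun a => (a == b)%:R.
exists (\sum_b nrm (u b)); first exact: sumr_ge0.
move=> e x xe.
have H (s : seq A) : nrm (fun a => \sum_(b <- s) x b * u b a) <= \sum_(b <- s) `|x b| * nrm (u b).
  elim: s => [|b s IH].
    by rewrite big_nil (_ : (fun=> _) = fun=> 0) ?nrm0 //; apply: funext => a; rewrite big_nil.
  rewrite big_cons -nrmZ.
  have -> : (fun a => \sum_(j <- b :: s) x j * u j a) =
     (fun a => (fun a => x b * u b a) a + (fun a => \sum_(j <- s) x j * u j a) a).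
    by apply: funext => a; rewrite big_cons.
  by apply: le_trans (nrmD _ _) _; rewrite lerD2l.
have -> : x = (fun a => \sum_b x b * u b a).
  apply: funext => a; rewrite (bigD1 a) //= big1 ?addr0 /u ?eqxx ?mulr1 // => b ba.
  by rewrite eq_sym (negbTE ba) mulr0.
apply: le_trans (H _) _; rewrite mulr_suml; apply: ler_sum => b _.
by rewrite mulrC ler_wpM2l.
Qed.

(** Equivalence of norms: [nrm], transported to row vectors, is Lipschitz for the sup norm and
    attains a positive minimum on its compact unit sphere. *)
Lemma coord_le_nrm : exists2 C, 0 < C & forall x a, `|x a| <= C * nrm x.
Proof.
pose n := #|A|; pose f (v : 'rV[R]_n) : R := nrm (fun a => v ord0 (enum_rank a)).
have [B B0 HB] := nrm_le_coord.
have fB (v w : 'rV[R]_n) : `|f v - f w| <= B * `|v - w|.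
  have fsub (v' w' : 'rV[R]_n) : f v' - f w' <= B * `|v' - w'|.
    rewrite lerBlDr; apply: le_trans (lerD (HB `|v' - w'| (fun a => (v' - w') ord0 (enum_rank a)) _) (lexx _)).
      apply: le_trans (nrmD _ _); rewrite /f le_eqVlt; apply/orP; left; apply/eqP.
      by congr nrm; apply: funext => a; rewrite !mxE subrK.
    move=> a; rewrite [leRHS]/Num.norm /= mx_normrE.
    by apply: (le_bigmax _ (fun ij => `|(v' - w') ij.1 ij.2|) (ord0, enum_rank a)).
  by rewrite ler_norml fsub andbT lerNl opprB distrC fsub.
have fc : continuous f.
  move=> v; apply/(@cvgrPdist_le _ _ _ (nbhs v) (nbhs_filter v)) => e e0.
  near=> w; apply: le_trans (fB _ _) _.
  have : `|v - w| <= e / (B + 1).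
    near: w; apply: cvgr_dist_le; [exact: cvg_id|by rewrite divr_gt0 // ltr_wpDl].
  rewrite ler_pdivlMr ?ltr_wpDl // => vw; apply: le_trans vw.
  by rewrite mulrC ler_wpM2l // lerDl.
pose K : set 'rV[R]_n := [set v | `|v| = 1].
have Kc : compact K.
  apply: bounded_closed_compact.
    by exists 1; split; [exact: num_real|move=> M M1 v /= ->; exact: ltW].
  apply: (@preimage_closed _ _ (fun v : 'rV[R]_n => `|v|) [set x | x = 1]).
    by move=> v _; exact: norm_continuous.
  exact: closed_eq.
have xv x : exists v : 'rV[R]_n, f v = nrm x /\ forall a, `|x a| <= `|v|.
  exists (\row_i x (enum_val i)); split.
    by rewrite /f; congr nrm; apply: funext => a; rewrite mxE enum_rankK.
  move=> a; rewrite [leRHS]/Num.norm /= mx_normrE.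
  have := le_bigmax 0 (fun ij => `|(\row_i x (enum_val i) : 'rV[R]_n) ij.1 ij.2|) (ord0, enum_rank a).
  by rewrite /= mxE enum_rankK.
have fZ r v : f (r *: v) = `|r| * f v.
  by rewrite /f -nrmZ; congr nrm; apply: funext => a; rewrite mxE.
have [m m0 fm] : exists2 m, 0 < m & forall v, K v -> m <= f v.
  (* The sphere is empty when [A] is, and then any positive constant works. *)
  have [K0|/set0P K0] := eqVneq K set0.
    by exists 1 => // v; rewrite K0.
  have [v Kv vmin] := EVT_min_rV K0 Kc (continuous_subspaceT fc).
  exists (f v) => //; last by move=> w /mem_set /vmin.
  rewrite lt_neqAle nrm_ge0 andbT eq_sym; apply/negP => /eqP fv0.
  have : v = 0.
    apply/rowP => i; rewrite mxE.
    case: Hnrm => _ /(_ _ fv0) /(_ (enum_val i)) + _ _.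
    by rewrite enum_valK.
  move: Kv; rewrite inE /K /= => + v0; rewrite v0 normr0 => /esym/eqP.
  by rewrite oner_eq0.
exists m^-1; first by rewrite invr_gt0.
move=> x a; have [v [<- xa]] := xv x.
have [v0|v0] := eqVneq v 0.
  by apply: le_trans (xa a) _; rewrite v0 normr0 mulr_ge0 ?nrm_ge0 ?invr_ge0 ?ltW.
apply: le_trans (xa a) _.
have v0' : 0 < `|v| by rewrite normr_gt0.
rewrite ler_pdivlMl //.
have := fm (`|v|^-1 *: v); rewrite fZ normfV normr_id ler_pdivlMl // mulrC; apply.
by rewrite /K /= normrZ normfV normr_id mulVf // gt_eqF.
Unshelve. all: by end_near.
Qed.

(** On an unbounded set [sup] would be a default value, and the duality inequality would be lost. *)
Lemma has_sup_dual_norm y : has_sup [set dotA y x | x in [set x | nrm x <= 1]].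
Proof.
have [C C0 HC] := coord_le_nrm.
split; first by exists (dotA y (fun=> 0)), (fun=> 0) => //=; rewrite nrm0.
exists (\sum_a `|y a| * C) => _ [x /= x1 <-].
rewrite /dotA; apply: ler_sum => a _; apply: le_trans (ler_norm _) _.
rewrite normrM ler_wpM2l //; apply: le_trans (HC x a) _.
by rewrite ger_pMr.
Qed.

Lemma dotA_le_dual_norm y x : dotA y x <= dual_norm nrm y * nrm x.
Proof.
have [x0|x0] := eqVneq (nrm x) 0.
  rewrite x0 mulr0 /dotA big1 // => a _.
  by case: Hnrm => _ /(_ _ x0) -> _ _; rewrite mulr0.
have nx : 0 < nrm x by rewrite lt_neqAle eq_sym x0 nrm_ge0.
rewrite -ler_pdivrMr // mulrC -dotAZ.
apply: (@sup_upper_bound _ _ (has_sup_dual_norm y)).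
by eexists; last reflexivity; rewrite /= nrmZ ger0_norm ?invr_ge0 // mulVf.
Qed.

(** This description of strict superlevel sets is the form that [measurable_affine_sup] takes as
    input. *)
Lemma lt_dual_normP y b : b < dual_norm nrm y <->
  exists2 x, nrm x <= 1 & b < dotA y x.
Proof.
split.
  move=> /(sup_gt (has_sup_dual_norm y).1) [_ [x /= x1 <-] bx].
  by exists x.
move=> [x x1 bx]; apply: lt_le_trans bx _.
by apply: (@sup_upper_bound _ _ (has_sup_dual_norm y)); exists x.
Qed.

Lemma nrm_sub_simplex_le2 (p q : A -> R) :
  (forall p, in_simplex p -> nrm p <= 1) -> in_simplex p -> in_simplex q ->
  nrm (fun a => p a - q a) <= 2.
Proof.
move=> H sp sq.
have -> : (fun a => p a - q a) = (fun a => p a + -1 * q a) by apply: funext => a; ring.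
have := nrmD p (fun a => -1 * q a); rewrite nrmZ normrN1 mul1r => /le_trans; apply.
by have := H _ sp; have := H _ sq; lra.
Qed.

End DualNorm.

Section DualNormF.
Context {R : realType} {S A : finType}.
Variable (nrm : (A -> R) -> R).
Hypothesis Hnrm : is_norm nrm.
Implicit Types (F : S -> A -> R) (x : A -> R).

Lemma dual_normF_ge0 F : 0 <= dual_normF nrm F.
Proof. by rewrite /dual_normF; exact: bigmax_ge_id. Qed.

Lemma dual_norm_le_dual_normF F s : dual_norm nrm (F s) <= dual_normF nrm F.
Proof. exact: (le_bigmax _ (fun s => dual_norm nrm (F s)) s). Qed.

Lemma dotA_le_dual_normF F s x : dotA (F s) x <= dual_normF nrm F * nrm x.
Proof.
apply: le_trans (dotA_le_dual_norm Hnrm _ _) _.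
by rewrite ler_wpM2r ?dual_norm_le_dual_normF //; case: Hnrm.
Qed.

End DualNormF.

(** * Discounted sums and the performance difference identity *)

Section DiscountedSum.
Context {R : realType}.
Variable gamma : R.
Hypothesis Hgamma : 0 <= gamma < 1.

Definition discount (b : nat -> R) : R := limn (series (fun t => gamma ^+ t * b t)).

Lemma cvg_geometric_bound (a : R) : cvgn (series (fun t => gamma ^+ t * a)).
Proof.
have -> : (fun t => gamma ^+ t * a) = geometric a gamma.
  by apply: funext => t; rewrite /geometric /= mulrC.
apply: is_cvg_geometric_series.
by case/andP: Hgamma => g0 g1; rewrite ger0_norm.
Qed.

Lemma is_cvg_discount (b : nat -> R) (B : R) : (forall t, `|b t| <= B) ->
  cvgn (series (fun t => gamma ^+ t * b t)).
Proof.
move=> bB; have g0 : 0 <= gamma by case/andP: Hgamma.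
apply: normed_cvg.
apply: (@series_le_cvg _ _ (fun t => gamma ^+ t * B)).
- by move=> n; rewrite /= normr_ge0.
- by move=> n; rewrite mulr_ge0 ?exprn_ge0 // (le_trans _ (bB n)).
- by move=> n /=; rewrite normrM normrX ger0_norm // ler_wpM2l ?exprn_ge0.
exact: cvg_geometric_bound.
Qed.

Lemma discount_cst (a : R) : discount (fun=> a) = a / (1 - gamma).
Proof.
have g : `|gamma| < 1 by case/andP: Hgamma => g0 g1; rewrite ger0_norm.
rewrite /discount.
have -> : (fun t => gamma ^+ t * a) = geometric a gamma.
  by apply: funext => t; rewrite /geometric /= mulrC.
by apply/cvg_lim => //; exact: cvg_geometric_series.
Qed.

Lemma discountZ (b : nat -> R) (B : R) (x : R) : (forall t, `|b t| <= B) ->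
  discount (fun t => x * b t) = x * discount b.
Proof.
move=> bB; have c := is_cvg_discount bB.
rewrite /discount; have -> : (fun t => gamma ^+ t * (x * b t)) =
  x *: (fun t => gamma ^+ t * b t).
  by apply: funext => t; rewrite /GRing.scale /= mulrCA.
by rewrite lim_seriesZ.
Qed.

Lemma discountD (b c : nat -> R) (B C : R) :
  (forall t, `|b t| <= B) -> (forall t, `|c t| <= C) ->
  discount (fun t => b t + c t) = discount b + discount c.
Proof.
move=> /is_cvg_discount cb /is_cvg_discount cc.
rewrite /discount; have -> : (fun t => gamma ^+ t * (b t + c t)) =
  (fun t => gamma ^+ t * b t) + (fun t => gamma ^+ t * c t).
  by apply: funext => t; rewrite mulrDr.
by rewrite lim_seriesD.
Qed.

Lemma discountS (b : nat -> R) (B : R) : (forall t, `|b t| <= B) ->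
  discount b = b 0%N + gamma * discount (fun t => b t.+1).
Proof.
move=> bB; have c := is_cvg_discount bB.
have c' : cvgn (series (fun t => gamma ^+ t * b t.+1)).
  by apply: is_cvg_discount => t; exact: bB.
rewrite /discount -[gamma * _]/(gamma *: _) -lim_seriesZ //.
have c2 : cvgn (series (gamma *: (fun t => gamma ^+ t * b t.+1))) by exact: is_cvg_seriesZ.
have E n : series (fun t => gamma ^+ t * b t) n.+1 =
   b 0%N + series (gamma *: (fun t => gamma ^+ t * b t.+1)) n.
  rewrite /series /= big_nat_recl // expr0 mul1r; congr (_ + _).
  by apply: eq_bigr => i _; rewrite exprS -mulrA.
apply/cvg_lim => //; rewrite -(@cvg_shiftS _ _ _).
under eq_fun do rewrite E.
by apply: cvgD; [exact: cvg_cst|].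
Qed.

Lemma discount_ge0 (b : nat -> R) (B : R) : (forall t, `|b t| <= B) ->
  (forall t, 0 <= b t) -> 0 <= discount b.
Proof.
move=> bB b0; apply: limr_ge; first exact: is_cvg_discount bB.
near=> n; apply: sumr_ge0 => i _; rewrite mulr_ge0 ?exprn_ge0 //.
by case/andP: Hgamma.
Unshelve. all: by end_near.
Qed.

Lemma discount_sum (I : finType) (b : I -> nat -> R) (B : R) :
  (forall i t, `|b i t| <= B) ->
  discount (fun t => \sum_i b i t) = \sum_i discount (b i).
Proof.
move=> bB.
have H (s : seq I) : discount (fun t => \sum_(i <- s) b i t) = \sum_(i <- s) discount (b i).
  elim: s => [|i s IH].
    rewrite big_nil -[RHS](mul0r (1 - gamma)^-1) -discount_cst.
    by congr discount; apply: funext => t; rewrite big_nil.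
  rewrite big_cons -IH -(@discountD _ _ B (\sum_(j <- s) B)) //.
    by congr discount; apply: funext => t; rewrite big_cons.
  move=> t; apply: le_trans (ler_norm_sum _ _ _) _.
  by apply: ler_sum => j _; exact: bB.
exact: H.
Qed.

End DiscountedSum.

(** * Occupation measure, Bellman equation and performance difference *)

Section Occupation.
Context {R : realType} {S A : finType}.
Variables (P : S -> A -> S -> R) (c : S -> A -> R) (gamma : R) (h : S -> (A -> R) -> R).
Hypothesis HP0 : forall s a q, 0 <= P s a q.
Hypothesis HP1 : forall s a, \sum_(q : S) P s a q = 1.
Hypothesis Hgamma : 0 <= gamma < 1.
Implicit Types (pi : S -> A -> R) (g : S -> R).

Lemma Ppi_ge0 pi s q : is_policy pi -> 0 <= Ppi P pi s q.
Proof. by move=> Hpi; apply: sumr_ge0 => a _; rewrite mulr_ge0 //; case: (Hpi s). Qed.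

Lemma Ppi_sum1 pi s : is_policy pi -> \sum_q Ppi P pi s q = 1.
Proof.
move=> Hpi; rewrite exchange_big /=; case: (Hpi s) => _ <-.
by apply: eq_bigr => a _; rewrite -mulr_sumr HP1 mulr1.
Qed.

Lemma stepd_ge0 pi t s q : is_policy pi -> 0 <= stepd P pi t s q.
Proof.
move=> Hpi; elim: t q => [|t IH] q /=; first exact: ler0n.
by apply: sumr_ge0 => q' _; rewrite mulr_ge0 // Ppi_ge0.
Qed.

Lemma stepd_sum1 pi t s : is_policy pi -> \sum_q stepd P pi t s q = 1.
Proof.
move=> Hpi; elim: t => [|t IH] /=.
  rewrite (bigD1 s) //= eqxx big1 ?addr0 // => q qs.
  by rewrite eq_sym (negbTE qs).
rewrite exchange_big /= -[RHS]IH; apply: eq_bigr => q _.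
by rewrite -mulr_sumr Ppi_sum1 // mulr1.
Qed.

Definition stepE pi t s g := \sum_q stepd P pi t s q * g q.

Lemma stepE0 pi s g : stepE pi 0 s g = g s.
Proof.
rewrite /stepE (bigD1 s) //= eqxx mul1r big1 ?addr0 // => q qs.
by rewrite eq_sym (negbTE qs) mul0r.
Qed.

Lemma stepES pi t s g :
  stepE pi t.+1 s g = stepE pi t s (fun q => \sum_q' Ppi P pi q q' * g q').
Proof.
rewrite /stepE /=.
under eq_bigr do rewrite mulr_suml.
rewrite exchange_big /=; apply: eq_bigr => q _.
by rewrite mulr_sumr; apply: eq_bigr => q' _; rewrite mulrA.
Qed.

Lemma stepESl pi t s g :
  stepE pi t.+1 s g = \sum_q Ppi P pi s q * stepE pi t q g.
Proof.
elim: t g => [|t IH] g.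
  by rewrite stepES stepE0; apply: eq_bigr => q _; rewrite stepE0.
by rewrite stepES IH; apply: eq_bigr => q _; rewrite stepES.
Qed.

Lemma stepE_norm_le pi t s g B : is_policy pi -> (forall q, `|g q| <= B) ->
  `|stepE pi t s g| <= B.
Proof.
move=> Hpi gB; apply: le_trans (ler_norm_sum _ _ _) _.
rewrite -[leRHS]mul1r -(stepd_sum1 t s Hpi) mulr_suml; apply: ler_sum => q _.
by rewrite normrM ger0_norm ?stepd_ge0 // ler_wpM2l ?stepd_ge0.
Qed.

Lemma stepED pi t s f g : stepE pi t s (fun q => f q + g q) = stepE pi t s f + stepE pi t s g.
Proof. by rewrite /stepE -big_split /=; apply: eq_bigr => q _; rewrite mulrDr. Qed.

Lemma stepEZ pi t s x g : stepE pi t s (fun q => x * g q) = x * stepE pi t s g.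
Proof. by rewrite /stepE mulr_sumr; apply: eq_bigr => q _; rewrite mulrCA. Qed.

(** The unnormalized occupation measure integrated against [g], kept as a series so that a time
    shift is an identity between series; [kappaE] supplies the factor [1 - gamma]. *)
Definition occ pi s g := discount gamma (fun t => stepE pi t s g).

Lemma fin_bounded g : exists B, forall q, `|g q| <= B.
Proof.
exists (\sum_q `|g q|) => q.
by rewrite (bigD1 q) //= lerDl; apply: sumr_ge0.
Qed.

Lemma kappaE pi s g : is_policy pi ->
  \sum_q kappa P gamma pi s q * g q = (1 - gamma) * occ pi s g.
Proof.
move=> Hpi; have [B HB] := fin_bounded g.
rewrite /occ /stepE (@discount_sum _ _ Hgamma _ _ B); last first.
  move=> q t; rewrite normrM ger0_norm ?stepd_ge0 // -[leRHS]mul1r ler_pM ?stepd_ge0 //.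
  rewrite -(stepd_sum1 t s Hpi) (bigD1 q) //= lerDl; apply: sumr_ge0 => q' _; exact: stepd_ge0.
rewrite mulr_sumr; apply: eq_bigr => q _.
have -> : (fun t => stepd P pi t s q * g q) = (fun t => g q * stepd P pi t s q).
  by apply: funext => t; rewrite mulrC.
rewrite (@discountZ _ _ Hgamma _ 1); first by rewrite /kappa /discount; ring.
move=> t; rewrite ger0_norm ?stepd_ge0 //.
by rewrite -(stepd_sum1 t s Hpi) (bigD1 q) //= lerDl; apply: sumr_ge0 => q' _; exact: stepd_ge0.
Qed.

Lemma kappa_ge0 pi s q : is_policy pi -> 0 <= kappa P gamma pi s q.
Proof.
move=> Hpi; rewrite mulr_ge0 //; first by case/andP: Hgamma => _ /ltW; rewrite subr_ge0.
apply: (@discount_ge0 _ _ Hgamma _ 1); last by move=> t; exact: stepd_ge0.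
move=> t; rewrite ger0_norm ?stepd_ge0 //.
by rewrite -(stepd_sum1 t s Hpi) (bigD1 q) //= lerDl; apply: sumr_ge0 => q' _; exact: stepd_ge0.
Qed.

Let g1 : 0 < 1 - gamma.
Proof. by case/andP: Hgamma => _; rewrite subr_gt0. Qed.

Lemma kappa_sum1 pi s : is_policy pi -> \sum_q kappa P gamma pi s q = 1.
Proof.
move=> Hpi; have := kappaE s (fun=> 1) Hpi.
under eq_bigr do rewrite mulr1; move=> ->.
rewrite /occ; have -> : (fun t => stepE pi t s (fun=> 1)) = fun=> 1.
  by apply: funext => t; rewrite /stepE; under eq_bigr do rewrite mulr1; rewrite stepd_sum1.
by rewrite discount_cst // mul1r mulfV // gt_eqF.
Qed.

(** Here the last transition is moved onto [g], which makes [g - gamma P g] telescope in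
    [performance_difference]; [occSl] peels off the first transition instead and yields the Bellman
    equation. *)
Lemma occS pi s g : is_policy pi ->
  occ pi s g = g s + gamma * occ pi s (fun q => \sum_q' Ppi P pi q q' * g q').
Proof.
move=> Hpi; have [B HB] := fin_bounded g.
rewrite /occ (@discountS _ _ Hgamma _ B); last by move=> t; exact: stepE_norm_le.
rewrite stepE0; congr (_ + _ * discount _ _).
by apply: funext => t; rewrite stepES.
Qed.

Lemma occSl pi s g : is_policy pi ->
  occ pi s g = g s + gamma * \sum_q Ppi P pi s q * occ pi q g.
Proof.
move=> Hpi; have [B HB] := fin_bounded g.
have sB q t : `|stepE pi t q g| <= B by exact: stepE_norm_le.
rewrite [LHS](@discountS _ _ Hgamma _ B) // stepE0; congr (_ + _ * _).
have -> : (fun t => stepE pi t.+1 s g) = fun t => \sum_q Ppi P pi s q * stepE pi t q g.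
  by apply: funext => t; rewrite stepESl.
rewrite (@discount_sum _ _ Hgamma _ _ B).
  by apply: eq_bigr => q _; rewrite (@discountZ _ _ Hgamma _ B).
move=> q t; rewrite normrM ger0_norm ?Ppi_ge0 // -[leRHS]mul1r ler_pM ?Ppi_ge0 //.
by rewrite -(Ppi_sum1 s Hpi) (bigD1 q) //= lerDl; apply: sumr_ge0 => q' _; exact: Ppi_ge0.
Qed.

Lemma occD pi s f g : is_policy pi ->
  occ pi s (fun q => f q + g q) = occ pi s f + occ pi s g.
Proof.
move=> Hpi; have [B HB] := fin_bounded g; have [C HC] := fin_bounded f.
rewrite /occ -(@discountD _ _ Hgamma _ _ C B); try by move=> t; exact: stepE_norm_le.
by congr discount; apply: funext => t; rewrite stepED.
Qed.

Lemma occZ pi s x g : is_policy pi ->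
  occ pi s (fun q => x * g q) = x * occ pi s g.
Proof.
move=> Hpi; have [B HB] := fin_bounded g.
rewrite /occ -(@discountZ _ _ Hgamma _ B); last by move=> t; exact: stepE_norm_le.
by congr discount; apply: funext => t; rewrite stepEZ.
Qed.

Lemma VfE pi s : Vf P c gamma h pi s = occ pi s (cpi c h pi).
Proof. by []. Qed.

Lemma Vf_bellman pi s : is_policy pi -> Vf P c gamma h pi s =
  cpi c h pi s + gamma * \sum_q Ppi P pi s q * Vf P c gamma h pi q.
Proof. by move=> Hpi; rewrite VfE occSl. Qed.

Lemma QfE pi s a : is_policy pi -> Qf P c gamma h pi s a =
  c s a + h s (pi s) + gamma * \sum_q P s a q * Vf P c gamma h pi q.
Proof.
move=> Hpi; have [B HB] := fin_bounded (cpi c h pi); congr (_ + _).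
have sB q t : `|stepE pi t q (cpi c h pi)| <= B by exact: stepE_norm_le.
have PB q t : `|P s a q * stepE pi t q (cpi c h pi)| <= B.
  rewrite normrM ger0_norm // -[leRHS]mul1r ler_pM //.
  by rewrite -(HP1 s a) (bigD1 q) //= lerDl; apply: sumr_ge0.
have -> : (fun t => gamma ^+ t.+1 * \sum_q' P s a q' *
    \sum_q stepd P pi t q' q * cpi c h pi q) =
   gamma *: (fun t => gamma ^+ t * \sum_q' P s a q' * stepE pi t q' (cpi c h pi)).
  by apply: funext => t; rewrite exprS -mulrA.
rewrite lim_seriesZ; last first.
  apply: (@is_cvg_discount _ _ Hgamma _ (\sum_(q : S) B)) => t.
  by apply: le_trans (ler_norm_sum _ _ _) (ler_sum _ _) => q _; exact: PB.
rewrite -/(discount gamma (fun t => \sum_q' P s a q' * stepE pi t q' (cpi c h pi))).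
rewrite (discount_sum Hgamma PB); congr (_ * _); apply: eq_bigr => q _.
by rewrite (discountZ Hgamma _ (sB q)).
Qed.

Lemma dotA_Qf pi pi' s : is_policy pi -> is_policy pi' ->
  dotA (Qf P c gamma h pi s) (pi' s) =
  cpi c h pi' s - h s (pi' s) + h s (pi s)
    + gamma * \sum_q Ppi P pi' s q * Vf P c gamma h pi q.
Proof.
move=> Hpi Hpi'; rewrite /dotA.
under eq_bigr do rewrite QfE // !mulrDl.
rewrite !big_split /= -mulr_sumr; case: (Hpi' s) => _ ->; rewrite mulr1.
rewrite /cpi addrK; congr (_ + _ + _).
  by apply: eq_bigr => a _; rewrite mulrC.
under eq_bigr do rewrite -mulrA mulr_suml.
rewrite -mulr_sumr; congr (_ * _); rewrite exchange_big /=; apply: eq_bigr => q _.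
by rewrite /Ppi mulr_suml; apply: eq_bigr => a _; ring.
Qed.

(** By the Bellman equation the integrand is [V - (c' + gamma P' V)], where [c'] and [P'] belong to
    [pi']. Under the occupation measure of [pi'], the part [V - gamma P' V] telescopes to [V s] and
    [c'] sums to the value of [pi']. *)
Lemma performance_difference pi pi' s : is_policy pi -> is_policy pi' ->
  \sum_q kappa P gamma pi' s q *
    (dotA (Qf P c gamma h pi q) (fun a => pi q a - pi' q a)
       + h q (pi q) - h q (pi' q))
  = (1 - gamma) * (Vf P c gamma h pi s - Vf P c gamma h pi' s).
Proof.
move=> Hpi Hpi'; rewrite kappaE //; congr (_ * _).
set V := Vf P c gamma h pi.
pose PV q := \sum_q' Ppi P pi' q q' * V q'.
have -> : (fun q => dotA (Qf P c gamma h pi q) (fun a => pi q a - pi' q a)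
       + h q (pi q) - h q (pi' q)) =
  (fun q => V q + -1 * (cpi c h pi' q + gamma * PV q)).
  apply: funext => q; rewrite dotAB !dotA_Qf // -/V -/(PV q).
  by rewrite [in RHS]/V (Vf_bellman q Hpi) -/V; ring.
rewrite occD // occZ // occD // occZ // (occS s V Hpi') VfE -/PV.
by ring.
Qed.

(** The variance under the probability vector [kappa] is nonnegative. *)
Lemma kappa_sqr_le pi s g : is_policy pi ->
  (\sum_q kappa P gamma pi s q * g q) ^+ 2 <= \sum_q kappa P gamma pi s q * g q ^+ 2.
Proof.
move=> Hpi; have [m mE] : exists m, \sum_q kappa P gamma pi s q * g q = m by eexists.
rewrite mE; have : 0 <= \sum_q kappa P gamma pi s q * (g q - m) ^+ 2.
  by apply: sumr_ge0 => q _; rewrite mulr_ge0 ?kappa_ge0 ?sqr_ge0.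
have -> : \sum_q kappa P gamma pi s q * (g q - m) ^+ 2 =
  \sum_q kappa P gamma pi s q * g q ^+ 2 - 2 * m * (\sum_q kappa P gamma pi s q * g q) +
   m ^+ 2 * \sum_q kappa P gamma pi s q.
  rewrite !mulr_sumr -sumrB -big_split /=.
  by apply: eq_bigr => q _; ring.
rewrite kappa_sum1 // mE; lra.
Qed.

End Occupation.

(** * Measurability of the MDP quantities *)

Section Measurability.
Context {R : realType} {A : finType} {d : measure_display} {T : measurableType d}.
Implicit Types (X : T -> A -> R).

(* The strict superlevel sets of [f] are preimages of open sets, that is, countable unions of preimages of rational boxes; the supremum need not be over a countable family. *)
Lemma measurable_affine_sup X (f : T -> R) (Fam : set (R * (A -> R))) :
  (forall a, measurable_fun setT (X ^~ a)) ->
  (forall w b, b < f w <-> exists2 u, Fam u & b < u.1 + dotA u.2 (X w)) ->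
  measurable_fun setT f.
Proof.
move=> mX Hf.
apply: (measurability _ (RGenOInfty.measurableE R)) => //= _ [_ [b ->] <-].
rewrite setTI.
pose U := [set y : A -> R | exists2 u, Fam u & b < u.1 + dotA u.2 y].
pose box (cn : {ffun A -> rat} * nat) :=
  [set y : A -> R | forall a, ratr (cn.1 a) - cn.2.+1%:R^-1 < y a < ratr (cn.1 a) + cn.2.+1%:R^-1].
pose F cn := if `[< box cn `<=` U >] then X @^-1` box cn else set0.
have -> : f @^-1` `]b, +oo[%classic = \bigcup_cn F cn.
  apply/seteqP; split => [w /=|w [cn _]]; last first.
    rewrite /F; case: asboolP => // bU /= /bU Uw.
    by rewrite in_itv /= andbT; apply/Hf.
  rewrite in_itv /= andbT => /Hf[[u v] Fuv /= buv].
  set x := X w in buv *.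
  set N := \sum_a `|v a|; have N0 : 0 <= N by exact: sumr_ge0.
  (* Points of the box differ from [x] by less than [2 e] in each coordinate, so the affine form
     drops by at most [2 N e], a fraction [N / (N + 1)] of its excess over [b]. *)
  pose e := (u + dotA v x - b) / (2 * (N + 1)).
  have e0 : 0 < e by rewrite divr_gt0 ?subr_gt0 // mulr_gt0 // ltr_wpDl.
  have [n ne] : exists n, n.+1%:R^-1 < e.
    have [n _ Hn] := near_infty_natSinv_lt (PosNum e0).
    by exists n; apply: (Hn n) => /=.
  have n0 : 0 < n.+1%:R^-1 :> R by rewrite invr_gt0.
  have Hc a : exists c : rat, x a - n.+1%:R^-1 < ratr c < x a + n.+1%:R^-1.
    have [|c /itvP cx] := @rat_in_itvoo R (x a - n.+1%:R^-1) (x a + n.+1%:R^-1).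
      by rewrite ltrBlDr -addrA ltrDl addr_gt0.
    by exists c; rewrite !cx.
  have [c cP] := choice Hc.
  exists ([ffun a => c a], n) => //; rewrite /F; case: asboolP => [_ /= a|].
    by rewrite ffunE -/x; move: (cP a) => /andP[xc cx]; rewrite ltrBlDr cx -ltrBlDr xc.
  case=> y /= By; exists (u, v) => //=.
  suff : dotA v x - dotA v y <= N * (2 * e).
    have -> : N * (2 * e) = (u + dotA v x - b) * (N / (N + 1)).
      by rewrite /e; field; rewrite gt_eqF // ltr_wpDl.
    have : N / (N + 1) < 1 by rewrite ltr_pdivrMr ?ltr_wpDl // mul1r ltrDl.
    move: (N / (N + 1)) => r r1.
    have : 0 < u + dotA v x - b by rewrite subr_gt0.
    by nra.
  rewrite -dotAB /dotA /N mulr_suml; apply: ler_sum => a _.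
  apply: le_trans (ler_norm _) _; rewrite normrM ler_wpM2l //.
  move: (By a) (cP a) ne; rewrite ffunE; move: (_^-1) (ratr _ : R) => r1 r2.
  by move=> /andP[? ?] /andP[? ?] ?; rewrite ler_norml; apply/andP; split; lra.
apply: countable_bigcupT_measurable; first exact: countableP.
move=> cn; rewrite /F; case: asboolP => // _.
have -> : X @^-1` box cn = \bigcap_(a in [set: A]) ((X ^~ a) @^-1`
    `]ratr (cn.1 a) - cn.2.+1%:R^-1, ratr (cn.1 a) + cn.2.+1%:R^-1[%classic).
  by apply/seteqP; split => [w /= H a _ /=|w /= H a]; [rewrite in_itv; exact: H|move: (H a I); rewrite /= in_itv].
apply: fin_bigcap_measurable => [|a _]; first exact: finite_finset.
by rewrite -[X in measurable X]setTI; apply: mX.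
Qed.

(** On the simplex [f] is the supremum of its tangent affine functions, the one based at the point
    itself attaining it. *)
Lemma measurable_subgrad X (f : (A -> R) -> R) (g : (A -> R) -> A -> R) :
  (forall a, measurable_fun setT (X ^~ a)) -> (forall w, in_simplex (X w)) ->
  (forall p p', in_simplex p -> in_simplex p' ->
     f p' + dotA (g p') (fun a => p a - p' a) <= f p) ->
  measurable_fun setT (fun w => f (X w)).
Proof.
move=> mX sX Hg.
apply: (@measurable_affine_sup X _
  [set u | exists2 p, in_simplex p & u = (f p - dotA (g p) p, g p)]) => // w b.
split.
  move=> bf; exists (f (X w) - dotA (g (X w)) (X w), g (X w)) => /=; last by lra.
  by exists (X w).
move=> [_ [p sp ->] /= bp]; apply: lt_le_trans bp _.
by have := Hg _ _ (sX w) sp; rewrite dotAB; lra.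
Qed.

Lemma measurable_dual_norm (nrm : (A -> R) -> R) X : is_norm nrm ->
  (forall a, measurable_fun setT (X ^~ a)) ->
  measurable_fun setT (fun w => dual_norm nrm (X w)).
Proof.
move=> Hnrm mX.
apply: (@measurable_affine_sup X _ [set u | u.1 = 0 /\ nrm u.2 <= 1]) => // w b.
have dotC x y : dotA x y = dotA y x :> R by apply: eq_bigr => a _; rewrite mulrC.
split.
  move=> /(lt_dual_normP Hnrm)[x x1 bx]; exists (0, x) => //=.
  by rewrite add0r dotC.
move=> [[u x] /= [-> x1]]; rewrite add0r dotC => bx.
by apply/(lt_dual_normP Hnrm); exists x.
Qed.

Lemma measurable_dual_normF (S : finType) (nrm : (A -> R) -> R) (F : T -> S -> A -> R) :
  is_norm nrm -> (forall s a, measurable_fun setT (fun w => F w s a)) ->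
  measurable_fun setT (fun w => dual_normF nrm (F w)).
Proof.
move=> Hnrm mF; rewrite /dual_normF.
elim: (index_enum S) => [|s r IH].
  by under eq_fun do rewrite big_nil; exact: measurable_cst.
under eq_fun do rewrite big_cons.
apply: measurable_maxr => //.
by apply: (@measurable_dual_norm nrm (fun w => F w s)).
Qed.

(** The gradient term is the pointwise limit of difference quotients of [om] with steps
    [1 / (n + 1)], so it inherits measurability from [om], which is a supremum of its tangents. *)
Lemma measurable_breg (nrm om : (A -> R) -> R) (gom : (A -> R) -> A -> R) X (q : A -> R) :
  is_norm nrm -> grad_on_simplex om gom -> strongly_convex1 nrm om ->
  (forall a, measurable_fun setT (X ^~ a)) -> (forall w, in_simplex (X w)) ->
  in_simplex q ->
  measurable_fun setT (fun w => breg om gom q (X w)).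
Proof.
move=> Hnrm Hgom Hom mX sX sq.
have mom (Y : T -> A -> R) : (forall a, measurable_fun setT (Y ^~ a)) -> (forall w, in_simplex (Y w)) ->
    measurable_fun setT (fun w => om (Y w)).
  move=> mY sY; apply: (@measurable_subgrad Y om gom) => // p p' sp sp'.
  by have := breg_ge0 Hgom Hom sp sp'; rewrite /breg; lra.
apply: measurable_funB; first by apply: measurable_funB => //; exact: mom.
pose quot (n : nat) w := (om (fun a => X w a + n.+1%:R^-1 * (q a - X w a)) - om (X w)) / n.+1%:R^-1.
apply: (@measurable_fun_cvg _ _ _ _ quot) => [n|w _].
  apply: measurable_funM => //; apply: measurable_funB; last exact: mom.
  apply: mom => [a|w].
    apply: measurable_funD => //; apply: measurable_funM => //.
    exact: measurable_funB.
  apply: in_simplex_segment => //; rewrite invr_ge0 ler0n /= invf_le1 ?ltr0n //.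
  by rewrite ler1n.
have /cvg_at_rightP := Hgom _ _ (sX w) sq; apply; split.
  by move=> n; rewrite invr_gt0.
exact: cvg_harmonic.
Qed.

End Measurability.

Section MeasurableMDP.
Context {R : realType} {S A : finType} {d : measure_display} {T : measurableType d}.
Variables (P : S -> A -> S -> R) (c : S -> A -> R) (gamma : R) (h : S -> (A -> R) -> R).
Hypothesis HP0 : forall s a q, 0 <= P s a q.
Hypothesis HP1 : forall s a, \sum_(q : S) P s a q = 1.
Hypothesis Hgamma : 0 <= gamma < 1.
Variable pi : T -> S -> A -> R.
Hypothesis Hpi : forall w, is_policy (pi w).
Hypothesis mpi : forall s a, measurable_fun setT (fun w => pi w s a).
Hypothesis mh : forall s, measurable_fun setT (fun w => h s (pi w s)).

Lemma measurable_Vf s : measurable_fun setT (fun w => Vf P c gamma h (pi w) s).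
Proof.
apply: (@measurable_fun_cvg _ _ _ _
  (fun n w => series (fun t => gamma ^+ t * stepE P (pi w) t s (cpi c h (pi w))) n)).
  move=> n; rewrite /series /=; apply: measurable_sum => t.
  apply: measurable_funM => //; apply: measurable_sum => q; apply: measurable_funM.
    elim: t q => [|t IH] q //=.
    apply: measurable_sum => q'; apply: measurable_funM => //.
    by apply: measurable_sum => a; apply: measurable_funM.
  apply: measurable_funD => //.
  by apply: measurable_sum => a; apply: measurable_funM.
move=> w _; have [B HB] := fin_bounded (cpi c h (pi w)).
by apply: (@is_cvg_discount _ _ Hgamma _ B) => t; exact: stepE_norm_le.
Qed.

Lemma measurable_Qf s a : measurable_fun setT (fun w => Qf P c gamma h (pi w) s a).
Proof.
under eq_fun do rewrite QfE //.
apply: measurable_funD; first exact: measurable_funD.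
apply: measurable_funM => //; apply: measurable_sum => q.
by apply: measurable_funM => //; exact: measurable_Vf.
Qed.

End MeasurableMDP.

(** * Integration against functions measurable for a sub-sigma-algebra *)

Section SubSigma.
Context {R : realType} {d : measure_display} {Omega : measurableType d}.
Variables (Pr : probability Omega R) (G0 : set (set Omega)).
Hypothesis HG : <<s G0 >> `<=` measurable.
Local Notation T' := (g_sigma_algebraType G0).
Implicit Types (F X Y D U Z : Omega -> R) (B : set Omega).

Lemma measurable_fun_sub_sigma Z : measurable_fun [set: T'] Z -> measurable_fun [set: Omega] Z.
Proof.
move=> mZ _ B mB; rewrite setTI; apply: HG.
by have := mZ measurableT B mB; rewrite setTI.
Qed.

Import HBNNSimple.

Lemma nnsfun_sum (f : {nnsfun T' >-> R}) : exists (N : nat) (y : 'I_N -> R) (B : 'I_N -> set Omega),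
  [/\ forall i, 0 <= y i, forall i, <<s G0 >> (B i) &
      forall w, f w = \sum_i y i * \1_(B i) w].
Proof.
pose s := finmap.enum_fset (fset_set (f @` setT)).
exists (size s), (fun i => s`_i), (fun i => f @^-1` [set s`_i]); split.
- move=> i; have : s`_i \in s by rewrite mem_nth.
  by rewrite in_fset_set ?inE //= => -[w _ <-].
- by move=> i; exact: (measurable_sfunP f).
- by move=> w; rewrite fimfunEord.
Qed.

Lemma integral_mulr_nnsfun (N : nat) (y : 'I_N -> R) (B : 'I_N -> set Omega) F :
  (forall w, 0 <= F w) -> measurable_fun setT F ->
  (forall i, 0 <= y i) -> (forall i, <<s G0 >> (B i)) ->
  (\int[Pr]_w ((\sum_i y i * \1_(B i) w) * F w)%:E =
   \sum_i (y i)%:E * \int[Pr]_(w in B i) (F w)%:E)%E.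
Proof.
move=> F0 mF y0 GB.
have mB i : measurable (B i) by exact: HG.
have mFi i : measurable_fun setT (fun w => (F w * \1_(B i) w)%:E).
  by apply/measurable_EFinP; apply: measurable_funM => //; exact: measurable_indic.
transitivity (\int[Pr]_w (\sum_i (y i)%:E * (F w * \1_(B i) w)%:E)%E)%E.
  apply: eq_integral => w _; rewrite mulr_suml -sumEFin; apply: eq_bigr => i _.
  by rewrite -EFinM; congr EFin; ring.
rewrite ge0_integral_sum //; last 2 first.
- by move=> i; apply: measurable_funeM.
- by move=> i w _; rewrite -EFinM lee_fin !mulr_ge0.
apply: eq_bigr => i _; rewrite ge0_integralZl_EFin //; last first.
  by move=> w _; rewrite lee_fin mulr_ge0.
by congr (_ * _)%E; rewrite [RHS]integral_mkcond epatch_indic.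
Qed.

(** Taking out what is known, for inequalities: linearity for simple [Z], then monotone convergence.
    The approximants are built on the generated sigma-algebra, so their level sets are admissible
    sets [B]. *)
Lemma le_integral_mulr_sub_sigma F1 F2 Z :
  (forall w, 0 <= F1 w) -> (forall w, 0 <= F2 w) ->
  measurable_fun setT F1 -> measurable_fun setT F2 ->
  (forall w, 0 <= Z w) -> measurable_fun [set: T'] Z ->
  (forall B, <<s G0 >> B ->
     (\int[Pr]_(w in B) (F1 w)%:E <= \int[Pr]_(w in B) (F2 w)%:E)%E) ->
  (\int[Pr]_w (Z w * F1 w)%:E <= \int[Pr]_w (Z w * F2 w)%:E)%E.
Proof.
move=> F10 F20 mF1 mF2 Z0 mZ H.
have mEZ : measurable_fun [set: T'] (EFin \o Z) by exact/measurable_EFinP.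
pose zn := nnsfun_approx (measurableT : measurable [set: T']) mEZ.
have zn_cvg w : zn n w @[n --> \oo] --> Z w.
  have Z0' x : [set: T'] x -> (0 <= (EFin \o Z) x)%E by rewrite lee_fin.
  have /fine_cvgP[_ h] := cvg_nnsfun_approx (measurableT : measurable [set: T']) mEZ Z0' (I : [set: T'] w).
  exact: h.
have zn_nd (m n : nat) w : (m <= n)%N -> zn m w <= zn n w.
  by move=> mn; have /lefP := nd_nnsfun_approx measurableT mEZ mn; apply.
have zn0 n w : 0 <= zn n w by exact: fun_ge0.
have mzn n : measurable_fun [set: Omega] (zn n).
  by apply: measurable_fun_sub_sigma; exact: measurable_funP.
have lim F : (forall w, 0 <= F w) -> measurable_fun setT F ->
   (\int[Pr]_w (zn n w * F w)%:E @[n --> \oo] --> \int[Pr]_w (Z w * F w)%:E)%E.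
  move=> F0 mF.
  have -> : (\int[Pr]_w (Z w * F w)%:E = \int[Pr]_w limn (fun n => (zn n w * F w)%:E))%E.
    apply: eq_integral => w _; apply/esym/cvg_lim => //.
    by apply: cvg_EFin; [near=> n | apply: cvgMl; exact: zn_cvg].
  apply: cvg_monotone_convergence => //.
  - by move=> n; apply/measurable_EFinP; exact: measurable_funM.
  - by move=> n w _; rewrite lee_fin mulr_ge0.
  - by move=> w _ m n mn; rewrite lee_fin ler_wpM2r // zn_nd.
have c1 := lim _ F10 mF1; have c2 := lim _ F20 mF2.
apply: (lee_cvg_to c1 c2); near=> n.
have [N [y [B [y0 GB znE]]]] := nnsfun_sum (zn n).
under eq_integral do rewrite znE; under [leRHS]eq_integral do rewrite znE.
rewrite !integral_mulr_nnsfun //; apply: lee_sum => i _.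
by apply: lee_wpmul2l; [rewrite lee_fin|exact: H].
Unshelve. all: by end_near.
Qed.

Lemma integrableM_bounded U X (b : R) : measurable_fun setT U ->
  (forall w, `|U w| <= b) -> Pr.-integrable setT (EFin \o X) ->
  Pr.-integrable setT (fun w => (U w * X w)%:E).
Proof.
move=> mU Ub iX.
apply: (@integrableMr _ _ _ Pr setT measurableT U (EFin \o X)) => //.
exists b; split; first exact: num_real.
by move=> M bM w _ /=; apply: le_trans (Ub w) (ltW _).
Qed.

(** Reduction to nonnegative functions by shifting both factors: [D + |D|] and [|D|] have equal
    integrals over sets of the sigma-algebra, and [U + b] is nonnegative. The shifts then cancel by
    integrability. *)
Lemma integral_bounded_mulr_eq0 D U (b : R) :
  Pr.-integrable setT (EFin \o D) ->
  (forall B, <<s G0 >> B -> (\int[Pr]_(w in B) (D w)%:E = 0)%E) ->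
  measurable_fun [set: T'] U -> (forall w, `|U w| <= b) ->
  (\int[Pr]_w (U w * D w)%:E = 0)%E.
Proof.
move=> iD D0 mU Ub; have mU' := measurable_fun_sub_sigma mU.
have mD : measurable_fun setT D by apply/measurable_EFinP; exact: (measurable_int _ iD).
have iN : Pr.-integrable setT (EFin \o (fun w => `|D w|)) by exact: (integrable_abse iD).
have mN : measurable_fun setT (fun w => `|D w|) by exact: measurableT_comp.
pose F1 w := D w + `|D w|; pose Z w := U w + b.
have F10 w : 0 <= F1 w by rewrite -lerBlDl sub0r ler_normr lexx orbT.
have Z0 w : 0 <= Z w by move: (Ub w); rewrite ler_norml => /andP[]; rewrite /Z; lra.
have Zb w : `|Z w| <= b + b.
  by apply: le_trans (ler_normD _ _) (lerD (Ub w) _); rewrite ger0_norm // (le_trans _ (Ub w)).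
have mZ : measurable_fun [set: T'] Z by exact: measurable_funD.
have mZ' := measurable_fun_sub_sigma mZ.
have mF1 : measurable_fun setT F1 by exact: measurable_funD.
have HB B : <<s G0 >> B ->
    (\int[Pr]_(w in B) (F1 w)%:E = \int[Pr]_(w in B) (`|D w|)%:E)%E.
  move=> GB; have mB := HG GB; under eq_integral do rewrite EFinD.
  rewrite integralD //; [|exact: integrableS iD|exact: integrableS iN].
  by rewrite D0 // add0e.
have E : (\int[Pr]_w (Z w * F1 w)%:E = \int[Pr]_w (Z w * `|D w|)%:E)%E.
  apply/eqP; rewrite eq_le; apply/andP; split;
    by apply: le_integral_mulr_sub_sigma => // B GB; rewrite HB.
have iZD := integrableM_bounded mZ' Zb iD.
have iZN := integrableM_bounded mZ' Zb iN.
have EZ : (\int[Pr]_w (Z w * D w)%:E = 0)%E.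
  move: E; under eq_integral do rewrite mulrDr EFinD.
  have fD := integrable_fin_num measurableT iZD.
  have fN := integrable_fin_num measurableT iZN.
  by rewrite integralD // -(fineK fD) -(fineK fN) -EFinD => -[h]; congr EFin; lra.
have iUD := integrableM_bounded mU' Ub iD.
have ibD : Pr.-integrable setT (fun w => (b * D w)%:E).
  by apply: (@integrableM_bounded (fun=> b) D `|b|) => //.
move: EZ; under eq_integral do rewrite /Z mulrDl EFinD.
rewrite integralD //.
have -> : (\int[Pr]_w (b * D w)%:E = 0)%E.
  under eq_integral do rewrite EFinM.
  rewrite integralZl // D0 ?mule0 //.
  exact: (@measurableT _ T').
by rewrite adde0.
Qed.

Lemma integral_set_bounded_mulr_eq0 D U (b : R) B :
  Pr.-integrable setT (EFin \o D) ->
  (forall B, <<s G0 >> B -> (\int[Pr]_(w in B) (D w)%:E = 0)%E) ->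
  measurable_fun [set: T'] U -> (forall w, `|U w| <= b) -> <<s G0 >> B ->
  (\int[Pr]_(w in B) (U w * D w)%:E = 0)%E.
Proof.
move=> iD D0 mU Ub GB.
rewrite integral_mkcond epatch_indic.
rewrite -[RHS](@integral_bounded_mulr_eq0 D (fun w => U w * \1_B w) b iD D0).
- by apply: eq_integral => w _; rewrite /= -EFinM; congr EFin; ring.
- by apply: measurable_funM => //; exact: (@measurable_indic _ T').
- move=> w; rewrite normrM indicE; case: (w \in B) => /=.
    by rewrite normr1 mulr1.
  by rewrite normr0 mulr0 (le_trans _ (Ub w)).
Qed.

(** The maximum of [X] and [F] equals [X] almost everywhere and dominates [F] everywhere, which
    allows the pointwise comparison of nonnegative integrals without integrability of [F]. *)
Lemma ae_le_integral_ge0 B F X : measurable B ->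
  (forall w, 0 <= F w) -> measurable_fun setT F ->
  Pr.-integrable setT (EFin \o X) -> {ae Pr, forall w, F w <= X w} ->
  (\int[Pr]_(w in B) (F w)%:E <= \int[Pr]_(w in B) (X w)%:E)%E.
Proof.
move=> mB F0 mF iX FX.
have mX : measurable_fun setT X by apply/measurable_EFinP; exact: (measurable_int _ iX).
have mM : measurable_fun setT (fun w => Num.max (X w) (F w)) by exact: measurable_maxr.
have -> : (\int[Pr]_(w in B) (X w)%:E = \int[Pr]_(w in B) (Num.max (X w) (F w))%:E)%E.
  apply: ae_eq_integral => //; try by apply: measurable_funTS; exact/measurable_EFinP.
  by apply: filterS FX => w Fw _; rewrite max_l.
apply: ge0_le_integral => //.
- by move=> w _; rewrite lee_fin.
- by apply: measurable_funTS; exact/measurable_EFinP.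
- by apply: measurable_funTS; exact/measurable_EFinP.
- by move=> w _; rewrite lee_fin le_max lexx orbT.
Qed.

(** A conditional moment bound phrased with set integrals: the centred part [D] vanishes and [W] is
    exchanged for its conditional mean, at most 2. Both exponential moment bounds of part (ii) are
    instances. *)
Lemma integral_set_le_affine B F D W Y (a b : R) : <<s G0 >> B -> 0 <= b ->
  (forall w, 0 <= F w) -> measurable_fun setT F ->
  Pr.-integrable setT (EFin \o D) ->
  (forall B, <<s G0 >> B -> (\int[Pr]_(w in B) (D w)%:E = 0)%E) ->
  is_cond_exp Pr <<s G0 >> W Y -> {ae Pr, forall w, Y w <= 2} ->
  {ae Pr, forall w, F w <= D w + (a + b * W w)} ->
  (\int[Pr]_(w in B) (F w)%:E <= \int[Pr]_(w in B) (cst (a + b * 2) w)%:E)%E.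
Proof.
move=> GB b0 F0 mF iD D0 [iW mY iY WY] Y2 FDW; have mB := HG GB.
have ic (r : R) : Pr.-integrable setT (EFin \o cst r) by exact: finite_measure_integrable_cst.
have ibW : Pr.-integrable setT (EFin \o (fun w => b * W w)).
  by apply: (@integrableM_bounded (fun=> b) W `|b|).
have ibY : Pr.-integrable setT (EFin \o (fun w => b * Y w)).
  by apply: (@integrableM_bounded (fun=> b) Y `|b|).
have iab : Pr.-integrable setT (EFin \o (fun w => a + b * W w)).
  exact: (integrableD measurableT (ic a) ibW).
have S (X : Omega -> R) : Pr.-integrable setT (EFin \o X) -> Pr.-integrable B (EFin \o X).
  by apply: integrableS.
have iall : Pr.-integrable setT (EFin \o (fun w => D w + (a + b * W w))).
  exact: (integrableD measurableT iD iab).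
apply: le_trans (ae_le_integral_ge0 mB F0 mF iall FDW) _.
under eq_integral do rewrite EFinD.
rewrite integralD //; [|exact: S|exact: S].
rewrite D0 // add0e; under eq_integral do rewrite EFinD.
rewrite (integralD mB (S _ (ic a)) (S _ ibW)).
have -> : (\int[Pr]_(w in B) (b * W w)%:E = \int[Pr]_(w in B) (b * Y w)%:E)%E.
  under eq_integral do rewrite EFinM; under [RHS]eq_integral do rewrite EFinM.
  by rewrite !integralZl ?WY //; exact: S.
have -> : (\int[Pr]_(w in B) (cst (a + b * 2) w)%:E =
   \int[Pr]_(w in B) (cst a w)%:E + \int[Pr]_(w in B) (cst (b * 2) w)%:E)%E.
  under eq_integral do rewrite EFinD.
  by rewrite (integralD mB (S _ (ic a)) (S _ (ic (b * 2)))).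
apply: leeD => //.
have mYr : measurable_fun setT Y by apply/measurable_EFinP; exact: (measurable_int _ iY).
(* Capping [Y] at 2 makes its almost sure bound pointwise. *)
have -> : (\int[Pr]_(w in B) (b * Y w)%:E = \int[Pr]_(w in B) (b * Num.min (Y w) 2)%:E)%E.
  apply: ae_eq_integral => //.
  - by apply: measurable_funTS; apply/measurable_EFinP; exact: measurable_funM.
  - by apply: measurable_funTS; apply/measurable_EFinP; apply: measurable_funM => //; exact: measurable_minr.
  - by apply: filterS Y2 => w Yw _; rewrite min_l.
apply: le_integral => //; last by move=> w _; rewrite lee_fin ler_wpM2l // ge_min lexx orbT.
  apply: S; apply: (@integrableM_bounded (fun=> b) (fun w => Num.min (Y w) 2) `|b|) => //.
  apply: (@le_integrable _ _ _ _ _ measurableT _ (fun w => (`|Y w| + 2)%:E)).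
  - by apply/measurable_EFinP; exact: measurable_minr.
  - move=> w _; rewrite /= lee_fin [leRHS]ger0_norm ?addr_ge0 //.
    by case: (leP (Y w) 2) => [_|_]; rewrite ?lerDl // ger0_norm // lerDr.
  - exact: (integrableD measurableT (integrable_abse iY) (ic 2)).
exact: S (ic _).
Qed.

End SubSigma.

(** * Products of conditionally bounded factors and Markov's inequality *)

Section Product.
Context {R : realType} {d : measure_display} {Omega : measurableType d}.
Variables (Pr : probability Omega R) (G : nat -> set (set Omega)).
Hypothesis HG : forall t, <<s G t >> `<=` measurable.
Hypothesis GS : forall t, <<s G t >> `<=` <<s G t.+1 >>.

(** The supermartingale argument: the product of the earlier factors is known at time [k], so the
    last factor may be replaced by its conditional bound [c k]. *)
Lemma integral_prod_le (F : nat -> Omega -> R) (c : nat -> R) (k : nat) :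
  (forall t w, 0 <= F t w) -> (forall t, 0 <= c t) ->
  (forall t, measurable_fun [set: g_sigma_algebraType (G t.+1)] (F t)) ->
  (forall t B, <<s G t >> B ->
    (\int[Pr]_(w in B) (F t w)%:E <= \int[Pr]_(w in B) (cst (c t) w)%:E)%E) ->
  (\int[Pr]_w (\prod_(t < k) F t w)%:E <= (\prod_(t < k) c t)%:E)%E.
Proof.
move=> F0 c0 mF H.
have mP n : measurable_fun [set: g_sigma_algebraType (G n)] (fun w => \prod_(t < n) F t w).
  elim: n => [|n IH].
    by under eq_fun do rewrite big_ord0; exact: measurable_cst.
  under eq_fun do rewrite big_ord_recr /=; apply: measurable_funM => //.
  move=> _ B mB; rewrite setTI; apply: GS.
  by have := IH measurableT B mB; rewrite setTI.
elim: k => [|k IH].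
  under eq_integral do rewrite big_ord0.
  by rewrite big_ord0 integral_cst // mul1e; exact: probability_le1.
under eq_integral do rewrite big_ord_recr /=.
have P0 w : 0 <= \prod_(t < k) F t w by exact: prodr_ge0.
have mFk : measurable_fun setT (F k) by exact: (measurable_fun_sub_sigma (@HG k.+1) (mF k)).
have step := le_integral_mulr_sub_sigma (@HG k) (F0 k) (fun=> c0 k) mFk
  (measurable_cst (c k)) P0 (mP k) (H k).
apply: le_trans step _.
rewrite big_ord_recr /= EFinM muleC.
under eq_integral do rewrite mulrC EFinM.
rewrite ge0_integralZl_EFin //.
- by apply: lee_wpmul2l => //; rewrite lee_fin.
- by move=> w _; rewrite lee_fin; exact: prodr_ge0.
- by apply/measurable_EFinP; exact: (measurable_fun_sub_sigma (@HG k) (mP k)).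
Qed.

Lemma probability_ge_expR (Z : Omega -> R) (L E : R) :
  (forall w, 0 <= Z w) -> measurable_fun setT Z ->
  (\int[Pr]_w (Z w)%:E <= E%:E)%E ->
  (Pr [set w | (expR L <= Z w)%R] <= (expR (- L) * E)%:E)%E.
Proof.
move=> Z0 mZ ZE; set B := [set w | _].
have mB : measurable B.
  have -> : B = Z @^-1` `[expR L, +oo[%classic.
    by apply/seteqP; split => w /=; rewrite in_itv /= andbT.
  by rewrite -[X in measurable X]setTI; exact: mZ.
rewrite EFinM -lee_pdivrMl ?expR_gt0 // expRN invrK.
apply: le_trans ZE; rewrite -integral_cst //.
have mZ' : measurable_fun setT (EFin \o Z) by exact/measurable_EFinP.
apply: (@le_trans _ _ (\int[Pr]_(w in B) (Z w)%:E)%E).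
  apply: ge0_le_integral => //; last exact: measurable_funTS.
  by move=> w _; rewrite lee_fin expR_ge0.
apply: ge0_subset_integral => //.
by move=> w _; rewrite lee_fin.
Qed.

End Product.

Lemma cond_exp_sum_mulr_sub {R : realType} {d : measure_display} {Omega : measurableType d}
    (Pr : probability Omega R) (G0 : set (set Omega)) (I : finType)
    (U X Y : I -> Omega -> R) (b : R) :
  <<s G0 >> `<=` measurable ->
  (forall i, is_cond_exp Pr <<s G0 >> (X i) (Y i)) ->
  (forall i, measurable_fun [set: g_sigma_algebraType G0] (U i)) ->
  (forall i w, `|U i w| <= b) ->
  Pr.-integrable setT (EFin \o (fun w => \sum_i U i w * (X i w - Y i w))) /\
  forall B, <<s G0 >> B -> (\int[Pr]_(w in B) (\sum_i U i w * (X i w - Y i w))%:E = 0)%E.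
Proof.
move=> HG XY mU Ub.
have iD i : Pr.-integrable setT (EFin \o (fun w => X i w - Y i w)).
  by case: (XY i) => iX _ iY _; exact: (integrableB measurableT iX iY).
have D0 i B : <<s G0 >> B -> (\int[Pr]_(w in B) (X i w - Y i w)%:E = 0)%E.
  move=> GB; have mB := HG _ GB; case: (XY i) => iX _ iY /(_ _ GB) E.
  have iXB : Pr.-integrable B (EFin \o X i) by exact: integrableS iX.
  have iYB : Pr.-integrable B (EFin \o Y i) by exact: integrableS iY.
  under eq_integral do rewrite EFinB.
  by rewrite integralB_EFin // E subee //; exact: (integrable_fin_num mB iYB).
have iU i : Pr.-integrable setT (fun w => (U i w * (X i w - Y i w))%:E).
  exact: (integrableM_bounded (measurable_fun_sub_sigma HG (mU i)) (Ub i) (iD i)).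
split.
  rewrite (_ : EFin \o _ = fun w => (\sum_i (U i w * (X i w - Y i w))%:E)%E).
    exact: integrable_sum.
  by apply: funext => w /=; rewrite sumEFin.
move=> B GB; have mB := HG _ GB.
under eq_integral do rewrite -sumEFin.
rewrite integral_sum //; last by move=> i; exact: integrableS (iU i).
by apply: big1 => i _; apply: (integral_set_bounded_mulr_eq0 HG (iD i) _ (mU i) (Ub i) GB); exact: D0.
Qed.

(** * The recursion satisfied along every sample path *)

Section Pathwise.
Context {R : realType} {S A : finType}.
Variables (P : S -> A -> S -> R) (c : S -> A -> R) (gamma : R).
Variables (nrm : (A -> R) -> R) (om : (A -> R) -> R) (gom : (A -> R) -> A -> R).
Variables (h : S -> (A -> R) -> R) (mu M : R) (pistar : S -> A -> R).
Hypothesis HP0 : forall s a q, 0 <= P s a q.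
Hypothesis HP1 : forall s a, \sum_(q : S) P s a q = 1.
Hypothesis Hgamma : 0 <= gamma < 1.
Hypothesis Hnrm : is_norm nrm.
Hypothesis Hnrm1 : forall p, in_simplex p -> nrm p <= 1.
Hypothesis Hgom : grad_on_simplex om gom.
Hypothesis Hom : strongly_convex1 nrm om.
Hypothesis Hstar : is_policy pistar.

Local Notation kap := (kappa P gamma pistar).

Definition kdot (F U : S -> A -> R) (s : S) : R := \sum_q kap s q * dotA (F q) (U q).

Definition kbreg (pi : S -> A -> R) (s : S) : R :=
  \sum_q kap s q * breg om gom (pistar q) (pi q).

Definition dev (pi : S -> A -> R) (q : S) (a : A) : R := pistar q a - pi q a.

Let kap0 s q : 0 <= kap s q. Proof. exact: kappa_ge0. Qed.
Let kap1 s : \sum_q kap s q = 1. Proof. exact: kappa_sum1. Qed.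

Lemma kdotB F G U s : kdot (fun q a => F q a - G q a) U s = kdot F U s - kdot G U s.
Proof. by rewrite /kdot -sumrB; apply: eq_bigr => q _; rewrite dotBA mulrBr. Qed.

(** Written as a single finite sum, the noise is a combination of coordinatewise errors with
    coefficients known before the sample is drawn, the form [cond_exp_sum_mulr_sub] handles. *)
Lemma kdot_pair F U s : kdot F U s = \sum_(i : S * A) kap s i.1 * U i.1 i.2 * F i.1 i.2.
Proof.
rewrite -(pair_bigA _ (fun q a => kap s q * U q a * F q a)) /=.
apply: eq_bigr => q _; rewrite /dotA mulr_sumr; apply: eq_bigr => a _; ring.
Qed.

Lemma kbreg_ge0 pi s : is_policy pi -> 0 <= kbreg pi s.
Proof. by move=> Hpi; apply: sumr_ge0 => q _; rewrite mulr_ge0 // (breg_ge0 Hgom Hom). Qed.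

Lemma kbreg_le pi s b : (forall q, breg om gom (pistar q) (pi q) <= b) -> kbreg pi s <= b.
Proof.
move=> H; rewrite -[leRHS]mul1r -(kap1 s) mulr_suml; apply: ler_sum => q _.
by rewrite ler_wpM2l.
Qed.

(** The witness is the [kappa]-average of [nrm (pistar - pi)]. The bound [N <= 2] controls the bias
    in (i); [N ^+ 2 <= 2 * kbreg], from strong convexity and [kappa_sqr_le], makes the noise in (ii)
    shrink with the distance to the optimum. *)
Lemma kdot_norm_le F pi s : is_policy pi ->
  exists N, [/\ `|kdot F (dev pi) s| <= dual_normF nrm F * N, 0 <= N, N <= 2 &
                N ^+ 2 <= 2 * kbreg pi s].
Proof.
move=> Hpi; have nrm_ge0 x : 0 <= nrm x by case: Hnrm.
pose r q := nrm (dev pi q).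
exists (\sum_q kap s q * r q); split.
- apply: le_trans (ler_norm_sum _ _ _) _; rewrite mulr_sumr; apply: ler_sum => q _.
  rewrite normrM ger0_norm // mulrCA ler_wpM2l // ler_norml; apply/andP; split.
    rewrite lerNl.
    have -> : - dotA (F q) (dev pi q) = dotA (F q) (fun a => -1 * dev pi q a).
      by rewrite dotAZ mulN1r.
    apply: le_trans (dotA_le_dual_normF Hnrm _ _ _) _; rewrite /r.
    by case: Hnrm => _ _ -> _; rewrite normrN1 mul1r.
  exact: dotA_le_dual_normF.
- by apply: sumr_ge0 => q _; rewrite mulr_ge0 ?nrm_ge0.
- apply: (@le_trans _ _ (\sum_q kap s q * 2)); last by rewrite -mulr_suml kap1 mul1r.
  apply: ler_sum => q _.
  by rewrite ler_wpM2l //; exact: (nrm_sub_simplex_le2 Hnrm Hnrm1 (Hstar q) (Hpi q)).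
- apply: le_trans (kappa_sqr_le HP0 HP1 Hgamma _ _ Hstar) _.
  rewrite /kbreg mulr_sumr; apply: ler_sum => q _; rewrite [leRHS]mulrCA ler_wpM2l //.
  have := breg_ge Hgom Hom (Hstar q) (Hpi q); rewrite -/(dev pi q) -/(r q).
  by lra.
Qed.

Hypothesis Hmu : 0 < mu.
Hypothesis Hh_strong : exists h' : S -> (A -> R) -> A -> R,
     forall s p p', in_simplex p -> in_simplex p' ->
       h s p - h s p' - dotA (h' s p') (fun a => p a - p' a)
         >= mu * breg om gom p p'.
Hypothesis Hlip : forall s p p', in_simplex p -> in_simplex p' ->
     h s p - h s p' <= M * nrm (fun a => p a - p' a).

Variables (p_ q_ : nat -> S -> A -> R).
Hypothesis Hp : forall t, is_policy (p_ t).
Hypothesis Hspmd : forall t s p, in_simplex p ->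
  (mu * t.+1%:R)^-1 * (dotA (q_ t s) (p_ t.+1 s) + h s (p_ t.+1 s)) +
     breg om gom (p_ t.+1 s) (p_ t s) <=
  (mu * t.+1%:R)^-1 * (dotA (q_ t s) p + h s p) + breg om gom p (p_ t s).

Local Notation V pi := (Vf P c gamma h pi).
Local Notation Q pi := (Qf P c gamma h pi).

Definition noise t s := kdot (fun q a => q_ t q a - Q (p_ t) q a) (dev (p_ t)) s.

Lemma pathwise_step t s :
  (1 - gamma) * (V (p_ t) s - V pistar s) + mu * t.+2%:R * kbreg (p_ t.+1) s <=
  mu * t.+1%:R * kbreg (p_ t) s
   + (dual_normF nrm (q_ t) ^+ 2 + M ^+ 2) / (mu * t.+2%:R) + noise t s.
Proof.
have [h' Hh'] := Hh_strong.
rewrite -(performance_difference c h HP0 HP1 Hgamma s (Hp t) Hstar).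
set C := (_ + M ^+ 2) / _; have CE : \sum_q kap s q * C = C by rewrite -mulr_suml kap1 mul1r.
rewrite -CE /kbreg /noise /kdot !mulr_sumr -!big_split /=.
apply: ler_sum => q _.
have := mirror_step Hnrm Hgom Hom Hmu (Hh' q) (Hlip q) (Hp t q) (Hp t.+1 q)
  (dotA_le_dual_normF Hnrm (q_ t) q) (Hspmd t q) (Hstar q).
rewrite -/C.
rewrite [dotA _ (dev _ _)]dotBA /dev !dotAB.
move: (breg _ _ _ _) (breg _ _ _ _) => b1 b0.
move: (mu * t.+1%:R) (mu * t.+2%:R) => e0 e1 H.
clearbody C; have := ler_wpM2l (kap0 s q) H; lra.
Qed.

Lemma pathwise_sum j s :
  (1 - gamma) * (\sum_(t < j) (V (p_ t) s - V pistar s)) + mu * j.+1%:R * kbreg (p_ j) s <=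
  mu * kbreg (p_ 0%N) s
   + \sum_(t < j) (dual_normF nrm (q_ t) ^+ 2 + M ^+ 2) / (mu * t.+2%:R)
   + \sum_(t < j) noise t s.
Proof.
elim: j => [|j IH]; first by rewrite !big_ord0 mulr0 !addr0 add0r mulr1.
rewrite !big_ord_recr /= mulrDr.
have := pathwise_step j s; move: IH.
move: (mu * j.+1%:R * _) (mu * j.+2%:R * _) => x0 x1.
move: (\sum_(_ < _) _) (\sum_(_ < _) _) (\sum_(_ < _) _) => y1 y2 y3.
by set C := _ / _; clearbody C; lra.
Qed.

End Pathwise.

(** * The stochastic iteration *)

Lemma integral_affine_sum_le {R : realType} {d : measure_display} {Omega : measurableType d}
    (Pr : probability Omega R) (D : Omega -> R) (W : nat -> Omega -> R) (a : R) (b : nat -> R) (k : nat) :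
  Pr.-integrable setT (EFin \o D) -> (\int[Pr]_w (D w)%:E = 0)%E ->
  (forall t, Pr.-integrable setT (EFin \o W t)) ->
  (forall t, (\int[Pr]_w (W t w)%:E <= 2%:E)%E) -> (forall t, 0 <= b t) ->
  Pr.-integrable setT (EFin \o (fun w => D w + (a + \sum_(t < k) b t * W t w))) /\
  (\int[Pr]_w (D w + (a + \sum_(t < k) b t * W t w))%:E <= (a + \sum_(t < k) b t * 2)%:E)%E.
Proof.
move=> iD D0 iW W2 b0.
have ic : Pr.-integrable setT (EFin \o cst a) by exact: finite_measure_integrable_cst.
have ibW t : Pr.-integrable setT (fun w => (b t * W t w)%:E).
  by apply: (@integrableM_bounded _ _ _ _ (fun=> b t) (W t) `|b t|).
have isum : Pr.-integrable setT (EFin \o (fun w => \sum_(t < k) b t * W t w)).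
  rewrite (_ : EFin \o _ = fun w => (\sum_(t < k) (b t * W t w)%:E)%E).
    by apply: integrable_sum => // t _; exact: ibW.
  by apply: funext => w /=; rewrite sumEFin.
have iaS : Pr.-integrable setT (EFin \o (fun w => a + \sum_(t < k) b t * W t w)).
  exact: (integrableD measurableT ic isum).
split; first exact: (integrableD measurableT iD iaS).
under eq_integral do rewrite EFinD.
rewrite integralD // D0 add0e; under eq_integral do rewrite EFinD.
rewrite (integralD measurableT ic isum) EFinD; apply: leeD.
  have PT : Pr setT = 1%E by exact: probability_setT.
  have -> : (\int[Pr]_w (EFin \o cst a) w = a%:E * Pr setT)%E.
    exact: (integral_cst Pr measurableT a%:E).
  by rewrite PT mule1.
under eq_integral do rewrite /= -sumEFin.
rewrite integral_sum // -sumEFin; apply: lee_sum => t _.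
under eq_integral do rewrite EFinM.
rewrite integralZl //; last exact: iW.
by rewrite EFinM; apply: lee_wpmul2l => //; rewrite lee_fin.
Qed.

Lemma ler_sum_ord_widen {R : realType} (f : nat -> R) j k :
  (forall t, 0 <= f t) -> (j <= k)%N -> \sum_(t < j) f t <= \sum_(t < k) f t.
Proof.
by move=> f0 jk; rewrite -(subnKC jk) big_split_ord /= lerDl; apply: sumr_ge0.
Qed.

(* [m ^+ 2] is the level with which [(t + 1) * kbreg] is compared in the induction on [t]. *)
Lemma deviation_constants {R : realType} (gamma sigma mu D0 q L T C : R) :
  0 <= gamma < 1 -> 0 < sigma -> 0 < mu -> 0 < D0 -> 0 <= q -> 1 <= L -> L <= T ->
  C = 6 * D0 / (1 - gamma) + 75 * q * T / ((1 - gamma) * mu ^+ 2)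
      + 108 * sigma ^+ 2 * L ^+ 3 / ((1 - gamma) ^+ 2 * mu ^+ 2) ->
  let m := Num.sqrt (C / 2) in
  [/\ 0 < m, Num.sqrt (3 * C) = Num.sqrt 6 * m &
      mu * D0 + 2 * mu^-1 * q * L + 2 * sigma * (Num.sqrt 6 * m) * L <= mu * m ^+ 2].
Proof.
move=> /andP[g0 g1] s0 mu0 D00 q0 L1 LT CE m.
have g : 0 < 1 - gamma by rewrite subr_gt0.
have gi : 1 <= (1 - gamma)^-1 by rewrite invf_ge1 // lerBlDr lerDl.
have L0 : 0 < L by exact: lt_le_trans L1.
have mi : 0 < mu^-1 by rewrite invr_gt0.
have sL : 0 <= (sigma * mu^-1 * L) ^+ 2 by rewrite sqr_ge0.
(* Factors at least 1 are discarded from [C]: powers of [1 / (1 - gamma)], one factor [L] of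
   [L ^+ 3], and the excess of [T] over [L]. *)
have KC : 3 * D0 + 75 / 2 * (q * mu^-1 ^+ 2 * L) + 54 * (sigma * mu^-1 * L) ^+ 2 <= C / 2.
  have invsqr (x : R) : (x ^+ 2)^-1 = x^-1 ^+ 2 by rewrite exprVn.
  rewrite CE [((1 - gamma) * _)^-1]invfM [((1 - gamma) ^+ 2 * _)^-1]invfM !invsqr; move: (1 - gamma)^-1 mu^-1 gi mi sL => u v u1 v0 sL.
  have u2 : 1 <= u ^+ 2 by rewrite exprn_ege1.
  have a1 : D0 <= D0 * u by rewrite ler_pMr.
  have a2 : q * v ^+ 2 * L <= q * v ^+ 2 * T * u.
    apply: (@le_trans _ _ (q * v ^+ 2 * T)).
      by rewrite ler_wpM2l // mulr_ge0 ?sqr_ge0.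
    have T0 : 0 <= T by apply: le_trans LT; exact: ltW.
    have z0 : 0 <= q * v ^+ 2 * T by rewrite mulr_ge0 // mulr_ge0 ?sqr_ge0.
    by rewrite ler_peMr.
  have a3 : (sigma * v * L) ^+ 2 <= (sigma * v * L) ^+ 2 * L * u ^+ 2.
    apply: (@le_trans _ _ ((sigma * v * L) ^+ 2 * L)); first by rewrite ler_peMr.
    by rewrite ler_peMr // mulr_ge0 // ltW.
  have -> : (6 * D0 * u + 75 * q * T * (u * v ^+ 2) + 108 * sigma ^+ 2 * L ^+ 3 * (u ^+ 2 * v ^+ 2)) / 2 =
     3 * (D0 * u) + 75 / 2 * (q * v ^+ 2 * T * u) +
     54 * ((sigma * v * L) ^+ 2 * L * u ^+ 2) by field.
  by lra.
have qL : 0 <= q * mu^-1 ^+ 2 * L by rewrite !mulr_ge0 ?sqr_ge0 // ltW.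
have C0 : 0 < C / 2 by lra.
have m0 : 0 < m by rewrite sqrtr_gt0.
have m2 : m ^+ 2 = C / 2 by rewrite sqr_sqrtr // ltW.
split => //.
  by rewrite /m -sqrtrM //; congr Num.sqrt; field.
rewrite -m2 in KC.
have r60 : 0 <= Num.sqrt 6 :> R by rewrite sqrtr_ge0.
(* Since [54 = (3 sqrt 6)^2], the noise term costs at most two thirds of [m ^+ 2]; the remaining
   third covers [D0] and [2 q L / mu^2], which explains the coefficients 3 and 75/2. *)
have key : 3 * (Num.sqrt 6 * (sigma * mu^-1 * L)) <= m.
  rewrite -(@ler_pXn2r _ 2) ?nnegrE ?(ltW m0) //; last first.
    by rewrite mulr_ge0 // mulr_ge0 // mulr_ge0 ?(ltW L0) // mulr_ge0 ?(ltW s0) ?(ltW mi).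
  by rewrite !exprMn sqr_sqrtr // -!exprMn; lra.
have E1 : 2 * sigma * (Num.sqrt 6 * m) * L =
   mu * (2 / 3 * (3 * (Num.sqrt 6 * (sigma * mu^-1 * L)) * m)) by field; rewrite gt_eqF.
have E2 : 2 * mu^-1 * q * L = mu * (2 * (q * mu^-1 ^+ 2 * L)) by field; rewrite gt_eqF.
rewrite E1 E2 -!mulrDr ler_pM2l //.
have k2 : 3 * (Num.sqrt 6 * (sigma * mu^-1 * L)) * m <= m ^+ 2 by rewrite expr2 ler_pM2r.
by move: k2; move: (3 * _ * m) => x; lra.
Qed.

Section Stochastic.
Context {R : realType} {S A : finType}.
Variables (P : S -> A -> S -> R) (c : S -> A -> R) (gamma : R).
Variables (nrm : (A -> R) -> R) (om : (A -> R) -> R) (gom : (A -> R) -> A -> R).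
Variables (h : S -> (A -> R) -> R) (mu M : R) (pistar : S -> A -> R).
Hypothesis HP0 : forall s a q, 0 <= P s a q.
Hypothesis HP1 : forall s a, \sum_(q : S) P s a q = 1.
Hypothesis Hgamma : 0 <= gamma < 1.
Hypothesis Hnrm : is_norm nrm.
Hypothesis Hnrm1 : forall p, in_simplex p -> nrm p <= 1.
Hypothesis Hgom : grad_on_simplex om gom.
Hypothesis Hom : strongly_convex1 nrm om.
Hypothesis Hmu : 0 < mu.
Hypothesis Hh_strong : exists h' : S -> (A -> R) -> A -> R,
     forall s p p', in_simplex p -> in_simplex p' ->
       h s p - h s p' - dotA (h' s p') (fun a => p a - p' a)
         >= mu * breg om gom p p'.
Hypothesis Hlip : forall s p p', in_simplex p -> in_simplex p' ->
     h s p - h s p' <= M * nrm (fun a => p a - p' a).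
Hypothesis Hopt : is_optimal P c gamma h pistar.

Context {d : measure_display} {Omega : measurableType d}.
Variables (Pr : probability Omega R) (G : nat -> set (set Omega)).
Hypothesis HG : forall t, <<s G t >> `<=` measurable.
Hypothesis GS : forall t, <<s G t >> `<=` <<s G t.+1 >>.
Variables (Qt pis : nat -> Omega -> S -> A -> R).
Hypothesis Hpis : forall t w, is_policy (pis t w).
Hypothesis Hspmd : forall t w s p, in_simplex p ->
  (mu * t.+1%:R)^-1 * (dotA (Qt t w s) (pis t.+1 w s) + h s (pis t.+1 w s)) +
     breg om gom (pis t.+1 w s) (pis t w s) <=
  (mu * t.+1%:R)^-1 * (dotA (Qt t w s) p + h s p) + breg om gom p (pis t w s).
Hypothesis mpis : forall t s a,
  measurable_fun [set: g_sigma_algebraType (G t)] (fun w => pis t w s a).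
Hypothesis mQt : forall t s a,
  measurable_fun [set: g_sigma_algebraType (G t.+1)] (fun w => Qt t w s a).

Variables (varsigma sigma Qbar Dbar0 : R).
Hypothesis Hvarsigma : 0 <= varsigma.
Hypothesis Hsigma : 0 < sigma.
Hypothesis HQbar : 0 < Qbar.

Local Notation V pi := (Vf P c gamma h pi).
Local Notation Q pi := (Qf P c gamma h pi).
Local Notation kap := (kappa P gamma pistar).
Local Notation kd F pi := (kdot P gamma pistar F (dev pistar pi)).
Local Notation kb pi := (kbreg P gamma om gom pistar pi).
Local Notation delta t w := (fun s a => Qt t w s a - Q (pis t w) s a).

Variable Y : nat -> S -> A -> Omega -> R.
Hypothesis HY : forall t s a, is_cond_exp Pr <<s G t >> (fun w => Qt t w s a) (Y t s a).
Hypothesis HYb : forall t, {ae Pr, forall w,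
  dual_normF nrm (fun s a => Y t s a w - Q (pis t w) s a) <= varsigma}.
Hypothesis HB2 : forall t, exists2 Y' : Omega -> R,
  is_cond_exp Pr <<s G t >>
    (fun w => expR (dual_normF nrm (delta t w) ^+ 2 / sigma ^+ 2)) Y' &
  {ae Pr, forall w, Y' w <= 2}.
Hypothesis HB3 : forall t, exists2 Y' : Omega -> R,
  is_cond_exp Pr <<s G t >>
    (fun w => expR (dual_normF nrm (fun s a => Qt t w s a) ^+ 2 / Qbar ^+ 2)) Y' &
  {ae Pr, forall w, Y' w <= 2}.
Hypothesis HD0 : forall w q, breg om gom (pistar q) (pis 0%N w q) <= Dbar0.

Let Hstar : is_policy pistar. Proof. by case: Hopt. Qed.
Let kap0 s q : 0 <= kap s q. Proof. exact: kappa_ge0. Qed.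
Let kap1 s : \sum_q kap s q = 1. Proof. exact: kappa_sum1. Qed.

(** * Adaptedness of the iterates and conditional centring of the noise *)

Lemma measurable_sigmaS t (f : Omega -> R) :
  measurable_fun [set: g_sigma_algebraType (G t)] f ->
  measurable_fun [set: g_sigma_algebraType (G t.+1)] f.
Proof.
move=> mf _ B mB; rewrite setTI; apply: GS.
by have := mf measurableT B mB; rewrite setTI.
Qed.

(** Bregman divergences are nonnegative, so [h'] provides genuine subgradients of [h] on the
    simplex. *)
Lemma measurable_reg_iter t s :
  measurable_fun [set: g_sigma_algebraType (G t)] (fun w => h s (pis t w s)).
Proof.
have [h' Hh'] := Hh_strong.
apply: (@measurable_subgrad _ _ _ (g_sigma_algebraType (G t)) (fun w => pis t w s) (h s) (h' s)) => //.
  by move=> w; exact: Hpis.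
move=> p p' sp sp'; have := Hh' s _ _ sp sp'.
have : 0 <= mu * breg om gom p p' by rewrite mulr_ge0 ?(ltW Hmu) ?(breg_ge0 Hgom Hom).
by lra.
Qed.

Lemma measurable_value_iter t s :
  measurable_fun [set: g_sigma_algebraType (G t)] (fun w => V (pis t w) s).
Proof.
apply: (@measurable_Vf _ _ _ _ (g_sigma_algebraType (G t))) => // s'; exact: measurable_reg_iter.
Qed.

Lemma measurable_qvalue_iter t s a :
  measurable_fun [set: g_sigma_algebraType (G t)] (fun w => Q (pis t w) s a).
Proof. by apply: (@measurable_Qf _ _ _ _ (g_sigma_algebraType (G t))) => // s'; exact: measurable_reg_iter. Qed.

Lemma measurable_breg_iter t q :
  measurable_fun [set: g_sigma_algebraType (G t)] (fun w => breg om gom (pistar q) (pis t w q)).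
Proof.
apply: (@measurable_breg _ _ _ (g_sigma_algebraType (G t)) nrm om gom (fun w => pis t w q)) => //.
by move=> w; exact: Hpis.
Qed.

Lemma measurable_kbreg_iter t s :
  measurable_fun [set: g_sigma_algebraType (G t)] (fun w => kb (pis t w) s).
Proof.
apply: measurable_sum => q; apply: measurable_funM => //.
exact: measurable_breg_iter.
Qed.

Lemma measurable_noise t s :
  measurable_fun [set: g_sigma_algebraType (G t.+1)] (fun w => kd (delta t w) (pis t w) s).
Proof.
apply: measurable_sum => q; apply: measurable_funM => //.
apply: measurable_sum => a; apply: measurable_funM.
  by apply: measurable_funB => //; apply: measurable_sigmaS; exact: measurable_qvalue_iter.
by apply: measurable_funB => //; exact: measurable_sigmaS.
Qed.

(** The bounded weight [ind] is 1 for (i) and [lam] times the truncation indicator for (ii); both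
    are known at time [t], so the centring of [Qt - Y] survives. *)
Lemma kdot_sub_bounded s t (ind : Omega -> R) (b : R) :
  measurable_fun [set: g_sigma_algebraType (G t)] ind -> (forall w, `|ind w| <= b) ->
  let D w := ind w * kd (fun q a => Qt t w q a - Y t q a w) (pis t w) s in
  Pr.-integrable setT (EFin \o D) /\
  forall B, <<s G t >> B -> (\int[Pr]_(w in B) (D w)%:E = 0)%E.
Proof.
move=> mi i1 D.
pose U (i : S * A) w := ind w * (kap s i.1 * dev pistar (pis t w) i.1 i.2).
have DE : D = fun w => \sum_(i : S * A) U i w * (Qt t w i.1 i.2 - Y t i.1 i.2 w).
  apply: funext => w; rewrite /D kdot_pair mulr_sumr; apply: eq_bigr => i _.
  by rewrite /U; ring.
rewrite DE.
apply: (@cond_exp_sum_mulr_sub _ _ _ Pr (G t) (S * A)%type U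
  (fun i w => Qt t w i.1 i.2) (fun i => Y t i.1 i.2) b) => //.
- move=> i; apply: measurable_funM => //; apply: measurable_funM => //.
  by apply: measurable_funB.
- move=> i w; rewrite /U normrM -[leRHS]mulr1 ler_pM // normrM -[leRHS]mulr1 ler_pM //.
    rewrite ger0_norm // -[leRHS](kap1 s) [leRHS](bigD1 i.1) //=.
    by rewrite lerDl; apply: sumr_ge0 => q _.
  have le1 (p : S -> A -> R) q a : is_policy p -> 0 <= p q a <= 1.
    move=> /(_ q) [p0 p1]; rewrite p0 -p1 (bigD1 a) //= lerDl.
    by apply: sumr_ge0.
  have /andP[? ?] := le1 _ i.1 i.2 Hstar; have /andP[? ?] := le1 _ i.1 i.2 (Hpis t w).
  by rewrite ler_norml /dev; apply/andP; split; lra.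
Qed.

Lemma kdot_le_bias s t :
  {ae Pr, forall w, kd (delta t w) (pis t w) s <=
     kd (fun q a => Qt t w q a - Y t q a w) (pis t w) s + 2 * varsigma}.
Proof.
apply: filterS (HYb t) => w bw.
have [N [Nb N0 N2 _]] := kdot_norm_le HP0 HP1 Hgamma Hnrm Hnrm1 Hgom Hom Hstar
  (fun q a => Y t q a w - Q (pis t w) q a) s (Hpis t w).
move: Nb; rewrite !kdotB ler_norml => /andP[_ Nb].
have : dual_normF nrm (fun q a => Y t q a w - Q (pis t w) q a) * N <= 2 * varsigma.
  rewrite mulrC; apply: ler_pM => //; exact: dual_normF_ge0.
by lra.
Qed.

Lemma integral_expR_le2 (X Y' : Omega -> R) t :
  (forall w, 0 <= X w) -> is_cond_exp Pr <<s G t >> X Y' -> {ae Pr, forall w, Y' w <= 2} ->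
  (\int[Pr]_w (X w)%:E <= 2%:E)%E.
Proof.
move=> X0 XY Y2; have iX : Pr.-integrable setT (EFin \o X) by case: XY.
have mX : measurable_fun setT X by apply/measurable_EFinP; exact: (measurable_int _ iX).
apply: le_trans (@integral_set_le_affine _ _ _ Pr (G t) (@HG t) setT X (fun=> 0) X Y' 0 1
  _ _ _ _ _ _ XY Y2 _) _ => //.
- exact: (@measurableT _ (g_sigma_algebraType (G t))).
- exact: (finite_measure_integrable_cst Pr 0 measurableT).
- by move=> B _; rewrite integral0_eq.
- by apply: aeW => w; rewrite mul1r !add0r.
- have PT : Pr setT = 1%E by exact: probability_setT.
  have -> : (\int[Pr]_w (cst (0 + 1 * 2) w)%:E = (0 + 1 * 2)%:E * Pr setT)%E.
    exact: (integral_cst Pr measurableT (0 + 1 * 2)%:E).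
  by rewrite PT mule1 add0r mul1r.
Qed.

Lemma value_gap_ge0 t w s : 0 <= V (pis t w) s - V pistar s.
Proof. by rewrite subr_ge0; case: Hopt => _; apply. Qed.

Let g1 : 0 < 1 - gamma.
Proof. by case/andP: Hgamma => _; rewrite subr_gt0. Qed.

Lemma integral_gap_le k s : (1 <= k)%N ->
  (\int[Pr]_w ((1 - gamma) * (\sum_(t < k) (V (pis t w) s - V pistar s))
     + mu * k%:R * kb (pis k w) s)%:E <=
   (mu * Dbar0 + mu^-1 * (Qbar ^+ 2 + M ^+ 2) * ln (2 * k%:R) + 2 * varsigma * k%:R)%:E)%E.
Proof.
move=> k1.
pose W t w := expR (dual_normF nrm (fun s a => Qt t w s a) ^+ 2 / Qbar ^+ 2).
pose b (t : nat) := Qbar ^+ 2 / (mu * t.+2%:R).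
(* The [- Qbar ^+ 2] comes from [x <= Qbar^2 (exp (x / Qbar^2) - 1)]: as [W] has mean at most 2, the
   squared estimate contributes [Qbar ^+ 2] rather than twice that. *)
pose a := mu * Dbar0 + \sum_(t < k) (M ^+ 2 - Qbar ^+ 2) / (mu * t.+2%:R) + 2 * varsigma * k%:R.
pose Dt t w := kd (fun q a => Qt t w q a - Y t q a w) (pis t w) s.
pose D w := \sum_(t < k) Dt t w.
have HDt t : Pr.-integrable setT (EFin \o Dt t) /\ (\int[Pr]_w (Dt t w)%:E = 0)%E.
  have m1 : measurable_fun [set: g_sigma_algebraType (G t)] ((fun=> 1) : Omega -> R) by exact: measurable_cst.
  have n1 (w : Omega) : `|(fun=> 1 : R) w| <= 1 by rewrite normr1.
  have [iD D0] := kdot_sub_bounded s m1 n1; split.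
    by apply: eq_integrable iD => // w _; rewrite /= mul1r.
  rewrite -(D0 setT (@measurableT _ (g_sigma_algebraType (G t)))).
  by apply: eq_integral => w _; rewrite /= mul1r.
have iD : Pr.-integrable setT (EFin \o D).
  rewrite (_ : EFin \o _ = fun w => (\sum_(t < k) (Dt t w)%:E)%E).
    by apply: integrable_sum => // t _; case: (HDt t).
  by apply: funext => w /=; rewrite sumEFin.
have D0 : (\int[Pr]_w (D w)%:E = 0)%E.
  under eq_integral do rewrite -sumEFin.
  rewrite integral_sum //; last by move=> t; case: (HDt t).
  by apply: big1 => t _; case: (HDt t).
have mu2 t : 0 < mu * t.+2%:R by rewrite mulr_gt0.
have b0 t : 0 <= b t by rewrite divr_ge0 ?sqr_ge0 // ltW.
have iW t : Pr.-integrable setT (EFin \o W t) by case: (HB3 t) => Y' [].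
have W2 t : (\int[Pr]_w (W t w)%:E <= 2%:E)%E.
  have [Y' XY Y2] := HB3 t; apply: (integral_expR_le2 _ XY Y2) => w; exact: expR_ge0.
have [iG Gle] := integral_affine_sum_le a k iD D0 iW W2 b0.
apply: (@le_trans _ _ (a + \sum_(t < k) b t * 2)%:E); last first.
  rewrite lee_fin /a.
  have -> : mu * Dbar0 + \sum_(t < k) (M ^+ 2 - Qbar ^+ 2) / (mu * t.+2%:R) + 2 * varsigma * k%:R
      + \sum_(t < k) b t * 2 =
      mu * Dbar0 + 2 * varsigma * k%:R +
      mu^-1 * (Qbar ^+ 2 + M ^+ 2) * \sum_(t < k) (t.+2%:R)^-1.
    rewrite -!addrA; congr (_ + _); rewrite addrCA; congr (_ + _).
    rewrite mulr_sumr -big_split /=; apply: eq_bigr => t _.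
    by rewrite /b invfM; ring.
  rewrite -addrA [leRHS]addrAC -addrA lerD2l lerD2l // ler_wpM2l //.
    by rewrite mulr_ge0 ?invr_ge0 ?(ltW Hmu) // addr_ge0 ?sqr_ge0.
  apply: le_trans (sum_invS2_le_ln k) _.
  by rewrite ler_ln ?posrE ?ltr0n ?mulr_gt0 ?ltr0n // -natrM ler_nat mul2n -addnn -addn1 leq_add2l.
apply: le_trans Gle.
apply: ae_le_integral_ge0 => //.
- move=> w; rewrite addr_ge0 //.
    by rewrite mulr_ge0 ?(ltW g1) //; apply: sumr_ge0 => t _; exact: value_gap_ge0.
  by rewrite !mulr_ge0 ?(ltW Hmu) // (kbreg_ge0 HP0 HP1 Hgamma Hgom Hom).
- apply: measurable_funD; apply: measurable_funM => //.
    apply: measurable_sum => t; apply: measurable_funB => //.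
    exact: (measurable_fun_sub_sigma (@HG t) (@measurable_value_iter t s)).
  exact: (measurable_fun_sub_sigma (@HG k) (@measurable_kbreg_iter k s)).
have := ae_foralln (fun t => kdot_le_bias s t); apply: filterS => w bw.
have := pathwise_sum c HP0 HP1 Hgamma Hnrm Hgom Hom Hstar Hmu Hh_strong Hlip
  (p_ := fun t => pis t w) (q_ := fun t => Qt t w) (fun t => Hpis t w)
  (fun t => Hspmd t w) k s.
set L1 := (1 - gamma) * _.
have d0 : 0 <= kb (pis k w) s by exact: (kbreg_ge0 HP0 HP1 Hgamma Hgom Hom).
have dD : kb (pis 0%N w) s <= Dbar0 by apply: (kbreg_le HP0 HP1 Hgamma Hstar).
have n1 : \sum_(t < k) noise P c gamma h pistar (fun t => pis t w) (fun t => Qt t w) t s <=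
    D w + 2 * varsigma * k%:R.
  have -> : 2 * varsigma * k%:R = \sum_(t < k) (2 * varsigma).
    by rewrite sumr_const card_ord mulr_natr.
  by rewrite -big_split /=; apply: ler_sum => t _; exact: bw.
have n2 : \sum_(t < k) (dual_normF nrm (Qt t w) ^+ 2 + M ^+ 2) / (mu * t.+2%:R) <=
   \sum_(t < k) (M ^+ 2 - Qbar ^+ 2) / (mu * t.+2%:R) + \sum_(t < k) b t * W t w.
  rewrite -big_split /=; apply: ler_sum => t _.
  have -> : b t * W t w = Qbar ^+ 2 * W t w / (mu * t.+2%:R) by rewrite /b mulrAC.
  rewrite -mulrDl ler_wpM2r ?invr_ge0 ?(ltW (mu2 t)) //.
  have Q2 : 0 < Qbar ^+ 2 by rewrite exprn_gt0.
  have := expR_ge1Dx (dual_normF nrm (Qt t w) ^+ 2 / Qbar ^+ 2).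
  rewrite -/(W t w) => /(ler_wpM2l (ltW Q2)).
  move: (dual_normF _ _ ^+ 2) (Qbar ^+ 2) Q2 (W t w) => x q q0 u.
  have -> : q * (1 + x / q) = q + x by field; rewrite gt_eqF.
  by lra.
have e1 : mu * k%:R * kb (pis k w) s <= mu * k.+1%:R * kb (pis k w) s.
  by rewrite ler_wpM2r // ler_wpM2l ?(ltW Hmu) // ler_nat.
have e2 : mu * kb (pis 0%N w) s <= mu * Dbar0 by rewrite ler_wpM2l ?(ltW Hmu).
rewrite /a; move: n1 n2 e1 e2.
move: (mu * k%:R * _) (mu * k.+1%:R * _) (mu * kb _ _) (mu * Dbar0) (2 * varsigma * k%:R).
move=> x1 x2 x3 x4 x5.
move: (\sum_(t < k) noise _ _ _ _ _ _ _ _ _) (\sum_(t < k) (dual_normF _ _ ^+ 2 + _) / _).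
move=> y1 y2.
move: (\sum_(t < k) _ / _) (\sum_(t < k) b t * _) => z1 z2.
by clearbody L1 D; lra.
Qed.

(** * Exponential moments of the squared estimates and of the truncated noise *)

Lemma integral_expR_sum_le1 (x : nat -> Omega -> R) (e : nat -> R) k :
  (forall t, measurable_fun [set: g_sigma_algebraType (G t.+1)] (x t)) ->
  (forall t B, <<s G t >> B ->
    (\int[Pr]_(w in B) (expR (x t w))%:E <= \int[Pr]_(w in B) (cst (expR (e t)) w)%:E)%E) ->
  (\int[Pr]_w (expR (\sum_(t < k) x t w - \sum_(t < k) e t))%:E <= 1)%E.
Proof.
move=> mx H.
have mex t : measurable_fun [set: g_sigma_algebraType (G t.+1)] (fun w => expR (x t w)).
  by apply: measurableT_comp => //; exact: mx.
have := integral_prod_le HG GS k (fun t w => expR_ge0 (x t w)) (fun t => expR_ge0 (e t)) mex H.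
rewrite -expR_sum => I.
have E0 := expR_gt0 (\sum_(t < k) e t).
under eq_integral do rewrite expRB expR_sum mulrC EFinM.
rewrite ge0_integralZl_EFin ?invr_ge0 ?expR_ge0 //.
- by rewrite -(@lee_pmul2l _ (expR (\sum_(t < k) e t))%:E) // muleA -EFinM mulfV ?gt_eqF // mul1e mule1.
- by move=> w _; rewrite lee_fin prodr_ge0 // => t _; exact: expR_ge0.
- apply/measurable_EFinP; apply: measurable_prod => t _.
  exact: (measurable_fun_sub_sigma (@HG t.+1) (mex t)).
Qed.

Lemma integral_expR_dual_le t B : <<s G t >> B ->
  (\int[Pr]_(w in B)
      (expR (t.+1%:R^-1 * (dual_normF nrm (fun s a => Qt t w s a) ^+ 2 / Qbar ^+ 2)))%:E <=
   \int[Pr]_(w in B) (cst (expR (t.+1%:R^-1 * ln 2)) w)%:E)%E.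
Proof.
move=> GB; set p := t.+1%:R^-1.
have p01 : 0 <= p <= 1 by rewrite invr_ge0 ler0n /= invf_le1 ?ltr0n // ler1n.
have [Y' XY Y2] := HB3 t.
rewrite -(expRM_interp2 p) mulrDr [_ * (p / 2 * 2)]mulrA.
apply: (@integral_set_le_affine _ _ _ Pr (G t) (@HG t) B _ (fun=> 0) _ Y' _ _ GB _ _ _ _ _ XY Y2) => //.
- by rewrite mulr_ge0 ?expR_ge0 // divr_ge0 //; case/andP: p01.
- apply: measurableT_comp => //; apply: measurable_funM => //; apply: measurable_funM => //.
  apply: measurable_funX; apply: (measurable_fun_sub_sigma (@HG t.+1)).
  by apply: (@measurable_dual_normF _ _ _ (g_sigma_algebraType (G t.+1))).
- exact: (finite_measure_integrable_cst Pr 0 measurableT).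
- by move=> B' _; rewrite integral0_eq.
- apply: aeW => w; rewrite add0r.
  by have := expRM_le_interp (dual_normF nrm (fun s a => Qt t w s a) ^+ 2 / Qbar ^+ 2) p01; lra.
Qed.

(** A real-valued indicator depending on [pi_t] only, hence known before [xi_t] is drawn. *)
Definition below (b : R) t s w : R := if kb (pis t w) s <= b then 1 else 0.

Lemma measurable_below b t s :
  measurable_fun [set: g_sigma_algebraType (G t)] (below b t s).
Proof.
rewrite /below.
have -> : (fun w => if kb (pis t w) s <= b then 1 else 0) =
   \1_[set w : g_sigma_algebraType (G t) | kb (pis t w) s <= b] :> (Omega -> R).
  apply: funext => w; rewrite indicE; case: ifPn => kbw; first by rewrite mem_set.
  by rewrite memNset //; exact/negP.
apply: (@measurable_indic _ (g_sigma_algebraType (G t))).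
have -> : [set w : g_sigma_algebraType (G t) | kb (pis t w) s <= b] =
   (fun w => kb (pis t w) s) @^-1` `]-oo, b]%classic.
  by apply/seteqP; split => w /=; rewrite in_itv.
by rewrite -[X in measurable X]setTI; exact: measurable_kbreg_iter.
Qed.

(** On the truncation event the squared noise is at most [2 m^2 / (t + 1)] times the squared error
    norm, so [lam = 1 / (2 sigma m)] makes [2 (lam * noise)^2] at most [1 / (t + 1)] times the
    exponent of Assumption B. The bias adds [lam * varsigma * sqrt 2 * m], as [N <= sqrt 2 * m]
    there. *)
Lemma integral_expR_noise_le (m lam : R) t s B : 0 < m ->
  lam = (2 * sigma * m)^-1 -> <<s G t >> B ->
  (\int[Pr]_(w in B)
     (expR (lam * (below (m ^+ 2 / t.+1%:R) t s w * kd (delta t w) (pis t w) s)))%:E <=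
   \int[Pr]_(w in B)
     (cst (expR (lam * (varsigma * (Num.sqrt 2 * m)) + t.+1%:R^-1 * ln 2)) w)%:E)%E.
Proof.
move=> m0 lamE GB; set p := t.+1%:R^-1.
have p01 : 0 <= p <= 1 by rewrite invr_ge0 ler0n /= invf_le1 ?ltr0n // ler1n.
have p0 : 0 < p by rewrite invr_gt0.
have lam0 : 0 < lam by rewrite lamE invr_gt0 !mulr_gt0.
have [Y' XY Y2] := HB2 t.
have bias0 : 0 <= lam * (varsigma * (Num.sqrt 2 * m)).
  by rewrite !mulr_ge0 ?sqrtr_ge0 ?(ltW m0) ?(ltW lam0).
set bias := lam * _ in bias0 *.
set ind := below _ _ _.
have ind01 w : ind w = 0 \/ ind w = 1 /\ kb (pis t w) s <= m ^+ 2 * p.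
  by rewrite /ind /below; case: ifPn => _; [right|left].
have mind : measurable_fun [set: g_sigma_algebraType (G t)] (fun w => lam * ind w).
  by apply: measurable_funM => //; exact: measurable_below.
have lind w : `|lam * ind w| <= lam.
  rewrite normrM gtr0_norm // ger_pMr //.
  by case: (ind01 w) => [->|[-> _]]; rewrite ?normr0 ?normr1.
have [iD D0] := kdot_sub_bounded s mind lind.
(* The affine bound has conditional mean at most [bias + 2 ^ p], and this is below
   [exp bias * 2 ^ p] because [2 ^ p >= 1]. *)
apply: (@le_trans _ _ (\int[Pr]_(w in B)
    (cst (bias + expR (p * ln 2) * (1 - p) + expR (p * ln 2) * (p / 2) * 2) w)%:E)%E); last first.
  apply: ge0_le_integral => //.
  - exact: (HG GB).
  - move=> w _; rewrite lee_fin /=.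
    have e0 := expR_ge0 (p * ln 2 : R); case/andP: p01 => _ p1.
    by rewrite !addr_ge0 // !mulr_ge0 ?subr_ge0 // ltW.
  - by apply/measurable_EFinP; exact: measurable_cst.
  - by apply/measurable_EFinP; exact: measurable_cst.
  - move=> w _; rewrite lee_fin /= expRD.
    have := expRM_interp2 p; have := expR_ge1Dx bias; have : 1 <= expR (p * ln 2).
      by rewrite -[leLHS]expR0 ler_expR mulr_ge0 ?(ltW p0) // ln_ge0 // ler1n.
    by nra.
apply: (@integral_set_le_affine _ _ _ Pr (G t) (@HG t) B _ _ _ Y' _ _ GB _ _ _ iD D0 XY Y2) => //.
- by rewrite mulr_ge0 ?expR_ge0 // divr_ge0 // ltW.
- apply: (measurable_fun_sub_sigma (@HG t.+1)).
  apply: measurableT_comp => //; apply: measurable_funM => //; apply: measurable_funM.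
    by apply: measurable_sigmaS; exact: measurable_below.
  exact: measurable_noise.
apply: filterS (HYb t) => w bw.
set Dd := kd (fun q a => Qt t w q a - Y t q a w) (pis t w) s.
set nz := kd (delta t w) (pis t w) s.
set y := dual_normF nrm (delta t w) ^+ 2 / sigma ^+ 2.
suff : expR (lam * (ind w * nz)) <= lam * ind w * Dd + bias + expR (p * y).
  have := expRM_le_interp y p01; lra.
apply: le_trans (expR_le_addr_expR_sqr _) _; apply: lerD; last first.
  rewrite ler_expR.
  have [N [Nn N0 _ N2]] := kdot_norm_le HP0 HP1 Hgamma Hnrm Hnrm1 Hgom Hom Hstar
    (delta t w) s (Hpis t w).
  case: (ind01 w) => [->|[-> kbK]].
    by rewrite mul0r mulr0 expr0n mulr0 mulr_ge0 ?(ltW p0) // divr_ge0 ?sqr_ge0.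
  have nz2 : nz ^+ 2 <= dual_normF nrm (delta t w) ^+ 2 * (2 * (m ^+ 2 * p)).
    rewrite -real_normK ?num_real //; apply: le_trans (_ : _ <= (dual_normF nrm (delta t w) * N) ^+ 2) _.
      by rewrite lerXn2r ?nnegrE ?mulr_ge0 ?dual_normF_ge0.
    rewrite exprMn ler_wpM2l ?sqr_ge0 //; apply: le_trans N2 _.
    by rewrite ler_wpM2l.
  rewrite mul1r.
  have -> : p * y = 2 * lam ^+ 2 * (dual_normF nrm (delta t w) ^+ 2 * (2 * (m ^+ 2 * p))).
    by rewrite /y lamE; field; rewrite !gt_eqF.
  have -> : 2 * (lam * nz) ^+ 2 = 2 * lam ^+ 2 * nz ^+ 2 by ring.
  by apply: ler_wpM2l nz2; rewrite mulr_ge0 ?sqr_ge0.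
have [N [Nn N0 _ N2]] := kdot_norm_le HP0 HP1 Hgamma Hnrm Hnrm1 Hgom Hom Hstar
    (fun q a => Y t q a w - Q (pis t w) q a) s (Hpis t w).
case: (ind01 w) => [->|[-> kbK]]; first by rewrite !(mul0r, mulr0) add0r.
have Nm : N <= Num.sqrt 2 * m.
  rewrite -(@ler_pXn2r _ 2) ?nnegrE ?mulr_ge0 ?sqrtr_ge0 ?(ltW m0) //.
  rewrite exprMn sqr_sqrtr //; apply: le_trans N2 _; rewrite ler_wpM2l //.
  by apply: le_trans kbK _; rewrite ger_pMr ?exprn_gt0 //; case/andP: p01.
have b1 : dual_normF nrm (fun q a => Y t q a w - Q (pis t w) q a) * N <=
    varsigma * (Num.sqrt 2 * m).
  by apply: ler_pM => //; exact: dual_normF_ge0.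
move: Nn; rewrite /Dd /nz !kdotB ler_norml => /andP[_ Nn].
rewrite mul1r mulr1 /bias -mulrDr ler_pM2l //.
by lra.
Qed.

(** A statement about one sample path. The bounds on truncated sums are required at every horizon
    [j <= k], because the induction removes the truncation one step at a time. *)
Lemma good_event_bound (m lam L : R) k w : (1 <= k)%N -> 1 + ln k%:R <= L ->
  varsigma * k%:R <= sigma -> 0 < m -> lam = (2 * sigma * m)^-1 -> 0 <= Dbar0 ->
  mu * Dbar0 + 2 * mu^-1 * (Qbar ^+ 2 + M ^+ 2) * L + 2 * sigma * (Num.sqrt 6 * m) * L
    <= mu * m ^+ 2 ->
  \sum_(t < k) t.+1%:R^-1 * (dual_normF nrm (fun s a => Qt t w s a) ^+ 2 / Qbar ^+ 2)
    - \sum_(t < k) t.+1%:R^-1 * ln 2 < L ->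
  (forall s j, (j <= k)%N ->
    \sum_(t < j) lam * (below (m ^+ 2 / t.+1%:R) t s w * kd (delta t w) (pis t w) s)
    - \sum_(t < j) (lam * (varsigma * (Num.sqrt 2 * m)) + t.+1%:R^-1 * ln 2) < L) ->
  forall s, (1 - gamma) * (\sum_(t < k) (V (pis t w) s - V pistar s))
     + mu * k%:R * kb (pis k w) s <=
   mu * Dbar0 + 2 * mu^-1 * (Qbar ^+ 2 + M ^+ 2) * L + 2 * sigma * (Num.sqrt 6 * m) * L.
Proof.
move=> k1 kL vk m0 lamE D0 Hm H1 H2 s.
have k0 : 1 <= k%:R :> R by rewrite ler1n.
have L1 : 1 <= L by have := ln_ge0 k0; lra.
have invn0 n : 0 <= n.+1%:R^-1 :> R by rewrite invr_ge0.
have Hk : \sum_(t < k) t.+1%:R^-1 <= L by apply: le_trans (sum_invS_le_ln k1) kL.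
have Hj j : (j <= k)%N -> \sum_(t < j) t.+1%:R^-1 <= L.
  by move=> jk; apply: le_trans (ler_sum_ord_widen invn0 jk) Hk.
have ln20 : 0 <= ln 2 :> R by rewrite ln_ge0 // ler1n.
have ln2H j : (j <= k)%N -> \sum_(t < j) t.+1%:R^-1 * ln 2 <= 18 / 25 * L.
  move=> /Hj HjL; rewrite -mulr_suml mulrC.
  by apply: ler_pM => //; [exact: sumr_ge0|exact: ln2_le].
have sm0 : 0 < sigma * m by rewrite mulr_gt0.
have r2 : Num.sqrt 2 <= 71 / 50 :> R.
  by rewrite -(@ler_pXn2r _ 2) ?nnegrE ?sqrtr_ge0 // sqr_sqrtr //; lra.
have r6 : 61 / 25 <= Num.sqrt 6 :> R.
  by rewrite -(@ler_pXn2r _ 2) ?nnegrE ?sqrtr_ge0 // sqr_sqrtr //; lra.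
(* In units of [sigma m L] the noise costs 2 from the Chernoff level, at most 71/50 from the
   accumulated bias and 36/25 from [2 ln 2] times the harmonic sum; the total stays below
   [2 sqrt 6]. *)
have HN j : (j <= k)%N ->
   \sum_(t < j) below (m ^+ 2 / t.+1%:R) t s w * kd (delta t w) (pis t w) s
   <= 2 * sigma * (Num.sqrt 6 * m) * L.
  move=> jk; have := H2 s j jk; rewrite -mulr_sumr big_split /= sumr_const card_ord -[_ *+ j]mulr_natr.
  set Sn := \sum_(t < j) (_ * _); have := ln2H j jk; set l2 := \sum_(t < j) _ => l2L.
  have vj : varsigma * j%:R <= sigma.
    by apply: le_trans vk; rewrite ler_wpM2l // ler_nat.
  have lam0 : 0 < 2 * sigma * m by rewrite -mulrA mulr_gt0.
  rewrite lamE => /ltW; rewrite -(ler_pM2l lam0).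
  have -> : 2 * sigma * m * ((2 * sigma * m)^-1 * Sn -
     ((2 * sigma * m)^-1 * (varsigma * (Num.sqrt 2 * m)) * j%:R + l2)) =
     Sn - varsigma * j%:R * (Num.sqrt 2 * m) - 2 * (sigma * m) * l2.
    by field; rewrite !gt_eqF.
  move=> hS.
  have b1 : varsigma * j%:R * (Num.sqrt 2 * m) <= sigma * m * (71 / 50).
    have -> : sigma * m * (71 / 50) = sigma * (71 / 50 * m) by ring.
    apply: ler_pM => //.
    - by rewrite mulr_ge0.
    - by rewrite mulr_ge0 ?sqrtr_ge0 // ltW.
    - by rewrite ler_wpM2r // ltW.
  have b2 : sigma * m * l2 <= sigma * m * (18 / 25 * L) by rewrite ler_pM2l.
  have b3 : sigma * m * (61 / 25) * L <= sigma * m * Num.sqrt 6 * L.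
    by rewrite ler_wpM2r ?(le_trans _ L1) // ler_pM2l.
  have b4 : sigma * m <= sigma * m * L by rewrite ler_pMr.
  move: b3; have -> : sigma * m * Num.sqrt 6 * L = sigma * (Num.sqrt 6 * m) * L by ring.
  lra.
have Q2 : 0 < Qbar ^+ 2 by rewrite exprn_gt0.
pose X t := dual_normF nrm (fun s a => Qt t w s a).
have HX : \sum_(t < k) t.+1%:R^-1 * X t ^+ 2 <= 2 * Qbar ^+ 2 * L.
  have E : Qbar ^+ 2 * \sum_(t < k) t.+1%:R^-1 * (X t ^+ 2 / Qbar ^+ 2) =
      \sum_(t < k) t.+1%:R^-1 * X t ^+ 2.
    rewrite mulr_sumr; apply: eq_bigr => t _.
    by rewrite mulrCA; congr (_ * _); rewrite mulrC divfK ?gt_eqF.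
  have -> : 2 * Qbar ^+ 2 * L = Qbar ^+ 2 * (2 * L) by ring.
  rewrite -E ler_pM2l //; move: H1 (ln2H k (leqnn k)); rewrite -/(X _).
  by move: (\sum_(t < k) _ * ln 2) (\sum_(t < k) _ * (_ / _)) => x1 x2; lra.
have HXM j : (j <= k)%N ->
   \sum_(t < j) (X t ^+ 2 + M ^+ 2) / (mu * t.+2%:R) <= 2 * mu^-1 * (Qbar ^+ 2 + M ^+ 2) * L.
  move=> jk.
  apply: (@le_trans _ _ (mu^-1 * (\sum_(t < k) t.+1%:R^-1 * X t ^+ 2 + M ^+ 2 * \sum_(t < k) t.+1%:R^-1))).
    rewrite [M ^+ 2 * _]mulr_sumr -big_split mulr_sumr /=.
    apply: le_trans (ler_sum_ord_widen (f := fun t => (X t ^+ 2 + M ^+ 2) / (mu * t.+2%:R)) _ jk) _.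
      by move=> t; rewrite divr_ge0 ?addr_ge0 ?sqr_ge0 // mulr_ge0 // ltW.
    apply: ler_sum => t _; rewrite [M ^+ 2 * _]mulrC -mulrDr mulrC invfM -mulrA.
    rewrite ler_wpM2l ?invr_ge0 ?(ltW Hmu) // ler_wpM2r ?addr_ge0 ?sqr_ge0 //.
    by rewrite lef_pV2 ?posrE // ler_nat.
  rewrite [2 * _]mulrC -!mulrA ler_wpM2l ?invr_ge0 ?(ltW Hmu) //.
  have : M ^+ 2 * \sum_(t < k) t.+1%:R^-1 <= M ^+ 2 * L by rewrite ler_wpM2l ?sqr_ge0.
  have : 0 <= M ^+ 2 * L by rewrite mulr_ge0 ?sqr_ge0 // (le_trans _ L1).
  by move: HX; lra.
have mkb0 : mu * kb (pis 0%N w) s <= mu * Dbar0.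
  by rewrite ler_wpM2l ?(ltW Hmu) // (kbreg_le HP0 HP1 Hgamma Hstar).
have step j : (j <= k)%N -> (forall t, (t < j)%N -> kb (pis t w) s <= m ^+ 2 / t.+1%:R) ->
   (1 - gamma) * (\sum_(t < j) (V (pis t w) s - V pistar s)) + mu * j.+1%:R * kb (pis j w) s <=
   mu * Dbar0 + 2 * mu^-1 * (Qbar ^+ 2 + M ^+ 2) * L + 2 * sigma * (Num.sqrt 6 * m) * L.
  move=> jk IH.
  have := pathwise_sum c HP0 HP1 Hgamma Hnrm Hgom Hom Hstar Hmu Hh_strong Hlip
    (p_ := fun t => pis t w) (q_ := fun t => Qt t w) (fun t => Hpis t w)
    (fun t => Hspmd t w) j s.
  (* Under the induction hypothesis all indicators before time [j] equal 1, so the true and the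
     truncated noise sums agree. *)
  have -> : \sum_(t < j) noise P c gamma h pistar (fun t => pis t w) (fun t => Qt t w) t s =
      \sum_(t < j) below (m ^+ 2 / t.+1%:R) t s w * kd (delta t w) (pis t w) s.
    by apply: eq_bigr => t _; rewrite /below IH // mul1r.
  move=> /le_trans; apply; apply: lerD (HN j jk); apply: lerD mkb0 _.
  exact: HXM.
have gap0 j : 0 <= (1 - gamma) * (\sum_(t < j) (V (pis t w) s - V pistar s)).
  by rewrite mulr_ge0 ?(ltW g1) //; apply: sumr_ge0 => t _; exact: value_gap_ge0.
(* The level [m ^+ 2 / (j + 1)] matches the coefficient [mu (j + 1)] of [pathwise_sum]: a total
   budget of at most [mu m^2] reproduces it once the nonnegative value gaps are dropped. *)
have below_all j : (j <= k)%N -> kb (pis j w) s <= m ^+ 2 / j.+1%:R.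
  elim/ltn_ind: j => j IH jk; have := step j jk _.
  have IH' t : (t < j)%N -> kb (pis t w) s <= m ^+ 2 / t.+1%:R.
    by move=> tj; apply: IH => //; rewrite (leq_trans (ltnW tj)).
  move=> /(_ IH') hj; rewrite ler_pdivlMr // -(ler_pM2l Hmu).
  have -> : mu * (kb (pis j w) s * j.+1%:R) = mu * j.+1%:R * kb (pis j w) s by ring.
  apply: le_trans Hm; apply: le_trans hj.
  by rewrite lerDr.
apply: le_trans (step k (leqnn k) _); last by move=> t tk; apply: below_all; exact: ltnW.
rewrite lerD2l ler_wpM2r //; first exact: (kbreg_ge0 HP0 HP1 Hgamma Hgom Hom).
by rewrite ler_wpM2l ?(ltW Hmu) // ler_nat.
Qed.

(** The sum [Z] has [1 + |S| (k + 1)] nonnegative terms, each of mean at most 1: one for the squared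
    estimates, and one per state and horizon [0, ..., k]. Where [Z < exp L], every term is below
    [exp L], which is the hypothesis of [good_event_bound]. *)
Lemma tail_probability (m lam L X : R) k : (1 <= k)%N -> 1 + ln k%:R <= L ->
  varsigma * k%:R <= sigma -> 0 < m -> lam = (2 * sigma * m)^-1 -> 0 <= Dbar0 ->
  mu * Dbar0 + 2 * mu^-1 * (Qbar ^+ 2 + M ^+ 2) * L + 2 * sigma * (Num.sqrt 6 * m) * L
    <= mu * m ^+ 2 ->
  mu * Dbar0 + 2 * mu^-1 * (Qbar ^+ 2 + M ^+ 2) * L + 2 * sigma * (Num.sqrt 6 * m) * L
    <= X ->
  (Pr [set w | exists s, (X < (1 - gamma) * (\sum_(t < k) (V (pis t w) s - V pistar s))
     + mu * k%:R * kb (pis k w) s)%R] <= (expR (- L) * (1 + #|S|%:R * k.+1%:R))%:E)%E.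
Proof.
move=> k1 kL vk m0 lamE D0 Hm HX; set E := [set w | _].
pose x0 t w := t.+1%:R^-1 * (dual_normF nrm (fun s a => Qt t w s a) ^+ 2 / Qbar ^+ 2).
pose e0 (t : nat) := t.+1%:R^-1 * ln 2 : R.
pose x1 s t w := lam * (below (m ^+ 2 / t.+1%:R) t s w * kd (delta t w) (pis t w) s).
pose e1 (t : nat) := lam * (varsigma * (Num.sqrt 2 * m)) + t.+1%:R^-1 * ln 2.
pose Z0 w := expR (\sum_(t < k) x0 t w - \sum_(t < k) e0 t).
pose Z1 (i : S * 'I_k.+1) w := expR (\sum_(t < i.2) x1 i.1 t w - \sum_(t < i.2) e1 t).
pose Z w := Z0 w + \sum_i Z1 i w.
have mx0 t : measurable_fun [set: g_sigma_algebraType (G t.+1)] (x0 t).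
  apply: measurable_funM => //; apply: measurable_funM => //; apply: measurable_funX.
  by apply: (@measurable_dual_normF _ _ _ (g_sigma_algebraType (G t.+1))).
have mx1 s t : measurable_fun [set: g_sigma_algebraType (G t.+1)] (x1 s t).
  apply: measurable_funM => //; apply: measurable_funM; last exact: measurable_noise.
  by apply: measurable_sigmaS; exact: measurable_below.
have I0 : (\int[Pr]_w (Z0 w)%:E <= 1)%E.
  by apply: integral_expR_sum_le1 => // t B GB; exact: integral_expR_dual_le.
have I1 i : (\int[Pr]_w (Z1 i w)%:E <= 1)%E.
  by apply: integral_expR_sum_le1 => // t B GB; exact: integral_expR_noise_le.
have msum (x : nat -> Omega -> R) (e : nat -> R) n :
    (forall t, measurable_fun [set: g_sigma_algebraType (G t.+1)] (x t)) ->
    measurable_fun setT (fun w => expR (\sum_(t < n) x t w - \sum_(t < n) e t)).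
  move=> mx; apply: measurableT_comp => //; apply: measurable_funB => //.
  by apply: measurable_sum => t; exact: (measurable_fun_sub_sigma (@HG t.+1) (mx t)).
have mZ0 : measurable_fun setT Z0 by exact: msum.
have mZ1 i : measurable_fun setT (Z1 i) by exact: msum.
have mZ : measurable_fun setT Z.
  by apply: measurable_funD => //; apply: measurable_sum => i.
have Z00 w : 0 <= Z w by rewrite addr_ge0 ?expR_ge0 //; apply: sumr_ge0 => i _; exact: expR_ge0.
have IZ : (\int[Pr]_w (Z w)%:E <= (1 + #|S|%:R * k.+1%:R)%:E)%E.
  under eq_integral do rewrite EFinD -sumEFin.
  rewrite ge0_integralD //; first last.
  - by apply: emeasurable_sum => i; exact/measurable_EFinP.
  - by move=> w _; apply: sume_ge0 => i _; rewrite lee_fin expR_ge0.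
  - exact/measurable_EFinP.
  - by move=> w _; rewrite lee_fin expR_ge0.
  rewrite EFinD; apply: leeD => //.
  rewrite ge0_integral_sum //; first last.
  - by move=> i w _; rewrite lee_fin expR_ge0.
  - by move=> i; exact/measurable_EFinP.
  apply: (@le_trans _ _ (\sum_(i : S * 'I_k.+1) 1%:E)%E).
    by apply: lee_sum => i _; exact: I1.
  by rewrite sumEFin lee_fin sumr_const card_prod card_ord natrM.
apply: le_trans (probability_ge_expR L Z00 mZ IZ).
apply: le_measure.
- rewrite inE; have -> : E = \bigcup_(s in [set: S])
     ((fun w => (1 - gamma) * (\sum_(t < k) (V (pis t w) s - V pistar s))
     + mu * k%:R * kb (pis k w) s) @^-1` `]X, +oo[%classic).
    apply/seteqP; split => [w [s Hs]|w [s _ Hs]]; exists s => //=.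
      by rewrite in_itv /= andbT.
    by move: Hs; rewrite /= in_itv /= andbT.
  apply: fin_bigcup_measurable => [|s _]; first exact: finite_finset.
  rewrite -[X in measurable X]setTI.
  suff : measurable_fun setT (fun w => (1 - gamma) * (\sum_(t < k) (V (pis t w) s - V pistar s))
     + mu * k%:R * kb (pis k w) s) by apply.
  apply: measurable_funD; apply: measurable_funM => //.
    apply: measurable_sum => t; apply: measurable_funB => //.
    exact: (measurable_fun_sub_sigma (@HG t) (@measurable_value_iter t s)).
  exact: (measurable_fun_sub_sigma (@HG k) (@measurable_kbreg_iter k s)).
- rewrite inE; have -> : [set w | expR L <= Z w] = Z @^-1` `[expR L, +oo[%classic.
    by apply/seteqP; split => w /=; rewrite in_itv /= andbT.
  by rewrite -[X in measurable X]setTI; exact: mZ.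
- move=> w [s Hs] /=; rewrite leNgt; apply/negP => ZL.
  have Z1ge0 : 0 <= \sum_i Z1 i w by apply: sumr_ge0 => i _; exact: expR_ge0.
  suff : (1 - gamma) * (\sum_(t < k) (V (pis t w) s - V pistar s))
     + mu * k%:R * kb (pis k w) s <= X by rewrite leNgt Hs.
  apply: le_trans HX; apply: (good_event_bound k1 kL vk m0 lamE D0 Hm).
    rewrite -ltr_expR; apply: le_lt_trans ZL.
    by rewrite /Z lerDl.
  move=> s' j jk; rewrite -ltr_expR; apply: le_lt_trans ZL.
  apply: (@le_trans _ _ (\sum_i Z1 i w)); last by rewrite lerDr expR_ge0.
  have jk' : (j < k.+1)%N by rewrite ltnS.
  rewrite (bigD1 (s', Ordinal jk')) //= lerDl.
  by apply: sumr_ge0 => i _; exact: expR_ge0.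
Qed.

(** Gaps and divergences are nonnegative, so the integral in [integral_gap_le] splits without
    separate integrability arguments. *)
Lemma expected_gap_le k s : (1 <= k)%N ->
  ((1 - gamma)%:E * (\sum_(t < k) \int[Pr]_w (V (pis t w) s - V pistar s)%:E)
     + (mu * k%:R)%:E *
       (\sum_q (kap s q)%:E * \int[Pr]_w (breg om gom (pistar q) (pis k w q))%:E)
   <= (mu * Dbar0 + mu^-1 * (Qbar ^+ 2 + M ^+ 2) * ln (2 * k%:R) + 2 * varsigma * k%:R)%:E)%E.
Proof.
move=> k1; apply: le_trans (integral_gap_le s k1).
have mV t : measurable_fun setT (fun w => (V (pis t w) s - V pistar s)%:E).
  apply/measurable_EFinP; apply: measurable_funB => //.
  exact: (measurable_fun_sub_sigma (@HG t) (@measurable_value_iter t s)).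
have mB q : measurable_fun setT (fun w => (breg om gom (pistar q) (pis k w q))%:E).
  apply/measurable_EFinP.
  exact: (measurable_fun_sub_sigma (@HG k) (@measurable_breg_iter k q)).
have V0 t w : (0 <= (V (pis t w) s - V pistar s)%:E)%E by rewrite lee_fin value_gap_ge0.
have B0 q w : (0 <= (breg om gom (pistar q) (pis k w q))%:E)%E.
  by rewrite lee_fin (breg_ge0 Hgom Hom) //; exact: Hpis.
under [leRHS]eq_integral do rewrite /kbreg EFinD !EFinM -!sumEFin.
under [leRHS]eq_integral do under [X in (_ + _ * X)%E]eq_bigr do rewrite EFinM.
have S0 w : (0 <= \sum_(t < k) (V (pis t w) s - V pistar s)%:E)%E by exact: sume_ge0.
have K0 w : (0 <= \sum_q (kap s q)%:E * (breg om gom (pistar q) (pis k w q))%:E)%E.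
  by apply: sume_ge0 => q _; rewrite mule_ge0 // lee_fin.
have mS : measurable_fun setT (fun w => \sum_(t < k) (V (pis t w) s - V pistar s)%:E)%E.
  by apply: emeasurable_sum => t; exact: mV.
have mK : measurable_fun setT
    (fun w => \sum_q (kap s q)%:E * (breg om gom (pistar q) (pis k w q))%:E)%E.
  by apply: emeasurable_sum => q; apply: measurable_funeM.
have muk0 : (0 <= mu%:E * k%:R%:E)%E by rewrite -EFinM lee_fin mulr_ge0 // ltW.
rewrite ge0_integralD //; first last.
- by apply: measurable_funeM.
- by move=> w _; rewrite mule_ge0.
- by apply: measurable_funeM.
- by move=> w _; rewrite mule_ge0 // lee_fin ltW.
rewrite -EFinM !ge0_integralZl_EFin ?mulr_ge0 ?(ltW g1) ?(ltW Hmu) //.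
rewrite !ge0_integral_sum //; first last.
- by move=> q w _; rewrite mule_ge0 // lee_fin.
- by move=> q; apply: measurable_funeM.
rewrite le_eqVlt; apply/orP; left; apply/eqP; congr (_ + _ * _)%E.
by apply: eq_bigr => q _; rewrite ge0_integralZl_EFin.
Qed.

End Stochastic.

Unset Implicit Arguments.

Theorem theorem4p4
  (R : realType) (S A : finType)
  (P : S -> A -> S -> R) (c : S -> A -> R) (gamma : R)
  (nrm : (A -> R) -> R) (om : (A -> R) -> R) (gom : (A -> R) -> A -> R)
  (h : S -> (A -> R) -> R) (mu_h M_h : R) (pistar : S -> A -> R)
  (d : measure_display) (Omega : measurableType d) (Pr : probability Omega R)
  (d' : measure_display) (Xi : measurableType d') (xi : nat -> Omega -> Xi)
  (Qt : nat -> Omega -> S -> A -> R) (pis : nat -> Omega -> S -> A -> R)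
  (pi0 : S -> A -> R) (varsigma sigma Qbar Dbar0 : R) (k : nat)
  (* the MDP *)
  (HP0 : forall s a q, 0 <= P s a q)
  (HP1 : forall s a, \sum_(q : S) P s a q = 1)
  (Hgamma : 0 <= gamma < 1)
  (* norm on R^{|A|} with max_{p in simplex} ||p|| <= 1 *)
  (Hnrm : is_norm nrm)
  (Hnrm_simplex : forall p, in_simplex p -> nrm p <= 1)
  (* distance generating function *)
  (Hgom : grad_on_simplex om gom)
  (Hom : strongly_convex1 nrm om)
  (* regularizer h: closed convex, mu_h-strongly convex w.r.t. D, M_h-Lipschitz *)
  (Hmu : 0 < mu_h)
  (Hh_convex : forall s, convex_on_simplex (h s))
  (Hh_strong : exists h' : S -> (A -> R) -> A -> R,
     forall s p p', in_simplex p -> in_simplex p' ->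
       h s p - h s p' - dotA (h' s p') (fun a => p a - p' a)
         >= mu_h * breg om gom p p')
  (Hh_lip : forall s p p', in_simplex p -> in_simplex p' ->
     h s p - h s p' <= M_h * nrm (fun a => p a - p' a))
  (* optimal policy *)
  (Hopt : is_optimal P c gamma h pistar)
  (* the random vectors xi_t and the SPMD iterates *)
  (Hxi : forall t, measurable_fun setT (xi t))
  (Hpi0 : is_policy pi0)
  (Hpis0 : forall w, pis 0%N w = pi0)
  (Hspmd : forall t w s,
     let eta := (mu_h * (t.+1)%:R)^-1 in
     let obj := fun p : A -> R =>
       eta * (dotA (Qt t w s) p + h s p) + breg om gom p (pis t w s) in
     in_simplex (pis t.+1 w s) /\
     forall p, in_simplex p -> obj (pis t.+1 w s) <= obj p)
  (* pi_t is determined by xi_[t-1]; Qtilde^{pi_t} is produced by xi_t *)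
  (Hpis_meas : forall t s a, G_measurable (gen_sigma xi t) (fun w => pis t w s a))
  (HQt_meas : forall t s a, G_measurable (gen_sigma xi t.+1) (fun w => Qt t w s a))
  (* Assumption B *)
  (Hvarsigma : 0 <= varsigma) (Hsigma : 0 < sigma) (HQbar : 0 < Qbar)
  (HB1 : forall t, exists Y : S -> A -> Omega -> R,
     (forall s a, is_cond_exp Pr (gen_sigma xi t) (fun w => Qt t w s a) (Y s a)) /\
     {ae Pr, forall w, dual_normF nrm
        (fun s a => Y s a w - Qf P c gamma h (pis t w) s a) <= varsigma})
  (HB2 : forall t, exists Y : Omega -> R,
     is_cond_exp Pr (gen_sigma xi t)
       (fun w => expR ((dual_normF nrm
          (fun s a => Qt t w s a - Qf P c gamma h (pis t w) s a)) ^+ 2 / sigma ^+ 2)) Y /\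
     {ae Pr, forall w, Y w <= 2})
  (HB3 : forall t, exists Y : Omega -> R,
     is_cond_exp Pr (gen_sigma xi t)
       (fun w => expR ((dual_normF nrm (fun s a => Qt t w s a)) ^+ 2 / Qbar ^+ 2)) Y /\
     {ae Pr, forall w, Y w <= 2})
  (* Dbar_0 *)
  (HD0pos : 0 < Dbar0)
  (HD0 : forall s p, in_simplex p -> breg om gom p (pi0 s) <= Dbar0)
  (Hk : (1 <= k)%N) :
  (* (i) *)
  (forall s : S,
    ((k%:R)^-1)%:E *
      (\sum_(t < k) \int[Pr]_w ((Vf P c gamma h (pis t w) s - Vf P c gamma h pistar s)%:E))
    + (mu_h / (1 - gamma))%:E *
      (\sum_(q : S) (kappa P gamma pistar s q)%:E *
          \int[Pr]_w ((breg om gom (pistar q) (pis k w q))%:E))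
    <= ((mu_h * Dbar0 + mu_h^-1 * (Qbar ^+ 2 + M_h ^+ 2) * ln (2 * k%:R)
         + 2 * varsigma * k%:R) / ((1 - gamma) * k%:R))%:E)%E
  /\
  (* (ii) *)
  (varsigma <= sigma / k%:R ->
   forall delta : R, 0 < delta <= 1 ->
   let L := ln (4 * k%:R * #|S|%:R / delta) in
   let C := 6 * Dbar0 / (1 - gamma)
            + 75 * (Qbar ^+ 2 + M_h ^+ 2) * L `^ (3 / 2) / ((1 - gamma) * mu_h ^+ 2)
            + 108 * sigma ^+ 2 * L ^+ 3 / ((1 - gamma) ^+ 2 * mu_h ^+ 2) in
   (Pr [set w | exists s : S, (
      (k%:R)^-1 * \sum_(t < k) (Vf P c gamma h (pis t w) s - Vf P c gamma h pistar s)
      + mu_h / (1 - gamma) *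
        \sum_(q : S) kappa P gamma pistar s q * breg om gom (pistar q) (pis k w q)
      > (mu_h * Dbar0 + (25 * mu_h^-1 * (Qbar ^+ 2 + M_h ^+ 2)
                          + 2 * sigma * Num.sqrt (3 * C)) * L `^ (3 / 2))
        / ((1 - gamma) * k%:R))%R]
    <= ((k.+1)%:R * delta)%:E)%E).
Proof.
pose G t := \bigcup_(i in `I_t) preimage_set_system setT (xi i) measurable.
have HG t : <<s G t >> `<=` measurable.
  apply: smallest_sub; first exact: sigma_algebra_measurable.
  move=> B [i _] [C mC <-]; exact: (Hxi i measurableT C mC).
have GS t : <<s G t >> `<=` <<s G t.+1 >>.
  apply: sub_sigma_algebra2; apply: bigcup_subset => i /= it.
  exact: ltnW.
have [Hstar Hmin] := Hopt.
have Hpis t w : is_policy (pis t w).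
  by case: t => [|t] s; [rewrite Hpis0; exact: Hpi0|case: (Hspmd t w s)].
have Hmin' t w s p : in_simplex p ->
  (mu_h * t.+1%:R)^-1 * (dotA (Qt t w s) (pis t.+1 w s) + h s (pis t.+1 w s)) +
     breg om gom (pis t.+1 w s) (pis t w s) <=
  (mu_h * t.+1%:R)^-1 * (dotA (Qt t w s) p + h s p) + breg om gom p (pis t w s).
  by case: (Hspmd t w s) => _; apply.
have toG t (X : Omega -> R) : G_measurable (gen_sigma xi t) X ->
    measurable_fun [set: g_sigma_algebraType (G t)] X.
  by move=> mX _ B mB; rewrite setTI; exact: mX.
have mpis t s a := toG t _ (Hpis_meas t s a).
have mQt t s a := toG t.+1 _ (HQt_meas t s a).
have [Y HY] := choice HB1.
have HY1 t s a : is_cond_exp Pr <<s G t >> (fun w => Qt t w s a) (Y t s a) by case: (HY t).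
have HYb t : {ae Pr, forall w,
    dual_normF nrm (fun s a => Y t s a w - Qf P c gamma h (pis t w) s a) <= varsigma}.
  by case: (HY t).
have HB2' t : exists2 Y' : Omega -> R, is_cond_exp Pr <<s G t >>
    (fun w => expR (dual_normF nrm
      (fun s a => Qt t w s a - Qf P c gamma h (pis t w) s a) ^+ 2 / sigma ^+ 2)) Y' &
    {ae Pr, forall w, Y' w <= 2}.
  by have [Y' []] := HB2 t; exists Y'.
have HB3' t : exists2 Y' : Omega -> R, is_cond_exp Pr <<s G t >>
    (fun w => expR (dual_normF nrm (fun s a => Qt t w s a) ^+ 2 / Qbar ^+ 2)) Y' &
    {ae Pr, forall w, Y' w <= 2}.
  by have [Y' []] := HB3 t; exists Y'.
have HD0' w q : breg om gom (pistar q) (pis 0%N w q) <= Dbar0 by rewrite Hpis0; exact: HD0.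
have g1 : 0 < 1 - gamma by case/andP: Hgamma => _; rewrite subr_gt0.
have k0 : 0 < k%:R :> R by rewrite ltr0n.
have gk0 : 0 < (1 - gamma) * k%:R by rewrite mulr_gt0.
split=> [s|vk delta /andP[delta0 delta1]].
  have := expected_gap_le HP0 HP1 Hgamma Hnrm Hnrm_simplex Hgom Hom Hmu Hh_strong Hh_lip
    Hopt HG Hpis Hmin' mpis HQbar HY1 HYb HB3' HD0' s Hk.
  set EV := (\sum_(t < k) _)%E; set EB := (\sum_q _)%E => H.
  have EV0 : (0 <= EV)%E.
    by apply: sume_ge0 => t _; apply: integral_ge0 => w _; rewrite lee_fin subr_ge0 Hmin.
  have EB0 : (0 <= EB)%E.
    apply: sume_ge0 => q _; apply: mule_ge0; first by rewrite lee_fin kappa_ge0.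
    by apply: integral_ge0 => w _; rewrite lee_fin (breg_ge0 Hgom Hom) //; exact: Hpis.
  have z0 : (0 <= (((1 - gamma) * k%:R)^-1)%:E)%E by rewrite lee_fin invr_ge0 ltW.
  have := lee_wpmul2l z0 H.
  rewrite ge0_muleDr ?mule_ge0 ?lee_fin ?mulr_ge0 ?(ltW g1) ?(ltW k0) ?(ltW Hmu) //.
  rewrite !muleA -!EFinM.
  have -> : ((1 - gamma) * k%:R)^-1 * (1 - gamma) = k%:R^-1.
    by field; rewrite !gt_eqF.
  have -> : ((1 - gamma) * k%:R)^-1 * (mu_h * k%:R) = mu_h / (1 - gamma).
    by field; rewrite !gt_eqF.
  by rewrite [((1 - gamma) * k%:R)^-1 * _]mulrC.
cbv zeta; set L := ln (4 * k%:R * #|S|%:R / delta).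
set C := (X in Num.sqrt (3 * X)).
set E := [set w | _].
(* For empty [S] the argument of the logarithm is 0, so [exp L] cannot be computed from it; the
   event is empty, having no state as witness. *)
have [S0|S0] := posnP #|S|.
  have -> : E = set0.
    apply/seteqP; split => // w [s _].
    by have := max_card (pred1 s); rewrite card1 S0.
  by rewrite measure0 lee_fin mulr_ge0 // ltW.
have nS0 : 0 < #|S|%:R :> R by rewrite ltr0n.
have kS0 : 0 < 4 * k%:R * #|S|%:R :> R by rewrite !mulr_gt0.
have kL : 1 + ln k%:R <= L.
  apply: (@le_trans _ _ (ln (4 * k%:R))).
    by rewrite lnM ?posrE // lerD2r ln4_ge1.
  rewrite ler_ln ?posrE ?mulr_gt0 ?divr_gt0 ?invr_gt0 //.
  rewrite ler_pdivlMr //; apply: (@le_trans _ _ (4 * k%:R)).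
    by rewrite ger_pMr // mulr_gt0.
  by rewrite ler_pMr ?mulr_gt0 // ler1n.
have k1 : 1 <= k%:R :> R by rewrite ler1n.
have L1 : 1 <= L by apply: le_trans kL; rewrite lerDl ln_ge0.
have LT : L <= L `^ (3 / 2).
  rewrite -[leLHS]powRr1 ?(le_trans _ L1) //; apply: ler_powR => //.
  by lra.
have q0 : 0 <= Qbar ^+ 2 + M_h ^+ 2 by rewrite addr_ge0 ?sqr_ge0.
have [m0 sqrtC Hm] := deviation_constants Hgamma Hsigma Hmu HD0pos q0 L1 LT (erefl C).
set m := Num.sqrt (C / 2) in m0 sqrtC Hm.
pose X := mu_h * Dbar0 + (25 * mu_h^-1 * (Qbar ^+ 2 + M_h ^+ 2)
   + 2 * sigma * Num.sqrt (3 * C)) * L `^ (3 / 2).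
have HX : mu_h * Dbar0 + 2 * mu_h^-1 * (Qbar ^+ 2 + M_h ^+ 2) * L
   + 2 * sigma * (Num.sqrt 6 * m) * L <= X.
  have -> : X = mu_h * Dbar0 + 25 * mu_h^-1 * (Qbar ^+ 2 + M_h ^+ 2) * L `^ (3 / 2)
     + 2 * sigma * (Num.sqrt 6 * m) * L `^ (3 / 2) by rewrite /X sqrtC; ring.
  have L0 : 0 <= L by exact: le_trans L1.
  have mq0 : 0 <= mu_h^-1 * (Qbar ^+ 2 + M_h ^+ 2) by rewrite mulr_ge0 // invr_ge0 ltW.
  apply: lerD; [rewrite lerD2l -[2 * _ * _]mulrA -[25 * _ * _]mulrA|]; apply: ler_pM => //.
  - by rewrite mulr_ge0.
  - by rewrite ler_wpM2r // ler_nat.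
  - by rewrite !mulr_ge0 ?sqrtr_ge0 // ltW.
have vk' : varsigma * k%:R <= sigma by rewrite -ler_pdivlMr.
have := tail_probability HP0 HP1 Hgamma Hnrm Hnrm_simplex Hgom Hom Hmu Hh_strong Hh_lip
  Hopt HG GS Hpis Hmin' mpis mQt Hvarsigma Hsigma HQbar HY1 HYb HB2' HB3' HD0'
  Hk kL vk' m0 erefl (ltW HD0pos) Hm HX.
set E' := [set w | _].
have -> : E' = E.
  apply/seteqP; split => w [s Hs]; exists s; move: Hs; rewrite /= ltr_pdivrMr //;
  set v := \sum_(t < k) _; rewrite /kbreg; set b := \sum_q _;
  have -> : (k%:R^-1 * v + mu_h / (1 - gamma) * b) * ((1 - gamma) * k%:R) =
     (1 - gamma) * v + mu_h * k%:R * b by (field; rewrite !gt_eqF).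
  - by [].
  - by [].
move=> /le_trans; apply; rewrite lee_fin.
(* What remains is [1 + |S| (k + 1) <= 4 k |S| (k + 1)]. *)
have -> : expR (- L) = delta / (4 * k%:R * #|S|%:R).
  by rewrite expRN lnK ?posrE ?divr_gt0 // invf_div.
rewrite mulrAC ler_pdivrMr // [k.+1%:R * delta]mulrC -[leRHS]mulrA ler_pM2l //.
have nS1 : 1 <= #|S|%:R :> R by rewrite ler1n.
rewrite -natr1; move: k%:R #|S|%:R k1 nS1 => x y x1 y1.
by nra.
Qed.
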